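(* Let $q$ be a prime power and let $c$ be chosen uniformly at random among the $q^2$ semisimple conjugacy classes of $SL(3,q)$. Then for every conjugacy class $C$ of $S_3$, $$\mathrm{Probability}(\Phi(c)=C)=\sum_{w\in C}\bigl(\text{coefficient of } w \text{ in } x_q\bigr).$$
   Context: A semisimple conjugacy class $c$ of $SL(n,q)$ is determined by the characteristic polynomial of its elements, and the polynomials that occur are exactly the monic degree $n$ polynomials over $F_q$ whose roots (with multiplicity) have product $1$. Such a polynomial factors as $\prod_i f_i^{a_i}$ with $f_i$ distinct monic irreducible over $F_q$ of degree $d_i$; $\Phi(c)$ is the conjugacy class of $S_n$ of permutations whose cycle type is the partition in which $d_i$ is repeated $a_i$ times for each $i$. For a positive integer $k$, the element $x_k$ (Cellini's element in type $A_{n-1}$) of the rational group algebra of $S_n$ is defined by: the coefficient of $w$ in $x_k$ is $\frac{1}{k^{n-1}}$ times the number of integer vectors $(v_1,\dots,v_n)$ such that (i) $v_1+\dots+v_n=0$; (ii) $v_1\ge v_2\ge\dots\ge v_n$ and $v_1-v_n\le k$; (iii) $v_i>v_{i+1}$ whenever $1\le i\le n-1$ and $w(i)>w(i+1)$; (iv) $v_1<v_n+k$ if $w(n)>w(1)$. Here $n=3$. *)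

(* Defs.v *)
From mathcomp Require Import all_boot all_order all_fingroup all_algebra.
From mathcomp Require Import closed_field mxred finmap boolp classical_sets.
From mathcomp Require Import functions cardinality.
From mathcomp Require Import zify.

Set Implicit Arguments.
Unset Strict Implicit.
Unset Printing Implicit Defensive.

Import Order.TTheory GroupScope GRing.Theory Num.Theory.

Local Open Scope ring_scope.

(* Algebraic closure of a finite field. *)
Definition alg_closure (F : finFieldType) : countClosedFieldType :=
  tag (countable_algebraic_closure F).

Definition to_alg_closure (F : finFieldType) : {rmorphism F -> alg_closure F} :=
  sval (tagged (countable_algebraic_closure F)).

Definition semisimple_mx (F : finFieldType) (n : nat) (A : 'M[F]_n) : Prop :=
  diagonalizable (map_mx (to_alg_closure F) A).

(* For n >= 1; the library's 'GL_n consists of matrices of size n.-1.+1. *)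
Definition SL (n : nat) (F : finFieldType) : {set {'GL_n[F]}} :=
  [set A : {'GL_n[F]} | \det (GLval A) == 1].

Lemma SL_group_set n F : group_set (SL n F).
Proof.
apply/group_setP; split=> [|A B]; first by rewrite inE det1.
by rewrite !inE GL_MxE det_mulmx => /eqP-> /eqP->; rewrite mulr1.
Qed.

Canonical SL_group n F := Group (SL_group_set n F).

Definition semisimple_classes (n : nat) (F : finFieldType) :
    {set {set {'GL_n[F]}}} :=
  [set A ^: SL n F | A in SL n F & `[< semisimple_mx (GLval A) >]].

(* p = \prod f_i ^ a_i, with f_i distinct monic irreducible of degree d_i and
   a_i > 0, and lambda lists (in any order) each d_i repeated a_i times. *)
Definition factor_type (F : fieldType) (p : {poly F}) (lambda : seq nat) : Prop :=
  exists fs : seq ({poly F} * nat),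
    [/\ uniq [seq fa.1 | fa <- fs],
        forall fa, fa \in fs ->
          [/\ fa.1 \is monic, irreducible_poly fa.1 & (0 < fa.2)%N],
        p = \prod_(fa <- fs) fa.1 ^+ fa.2
      & perm_eq lambda
          (flatten [seq nseq fa.2 (size (fa.1 : {poly F})).-1 | fa <- fs])].

(* Lengths of all cycles, fixed points included, in no particular order. *)
Definition cycle_type (T : finType) (w : {perm T}) : seq nat :=
  [seq #|(B : {set T})| | B <- enum (porbits w)].

(* For a conjugacy class c, [repr c] is an element of c; the characteristic
   polynomial does not depend on which one. *)
Definition Phi (n : nat) (F : finFieldType) (c : {set {'GL_n[F]}}) : {set 'S_n} :=
  [set w : 'S_n | `[< factor_type (char_poly (GLval (repr c))) (cycle_type w) >]].

(* Here the permutations are those of n.+1 points and the indices are 0-based: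
   v_1, ..., v_(n+1) are v 0 ord0, ..., v 0 ord_max. *)
Definition cellini_vectors (n k : nat) (w : 'S_n.+1) : set 'rV[int]_n.+1 :=
  [set v : 'rV[int]_n.+1 |
    [/\ \sum_(i < n.+1) v 0 i = 0,
        (forall i j : 'I_n.+1, (i <= j)%N -> v 0 j <= v 0 i)
          /\ v 0 ord0 - v 0 ord_max <= k%:Z,
        forall i j : 'I_n.+1, j = i.+1 :> nat -> (w j < w i)%N ->
          v 0 j < v 0 i
      & (w ord0 < w ord_max)%N -> v 0 ord0 < v 0 ord_max + k%:Z]]%classic.

(* [fset_set] returns the empty set on infinite sets. *)
Lemma finite_cellini_vectors n k (w : 'S_n.+1) :
  finite_set (cellini_vectors k w).
Proof.
pose f (g : {ffun 'I_n.+1 -> 'I_(k + k).+1}) : 'rV[int]_n.+1 :=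
  \row_i ((g i)%:Z - k%:Z).
apply: (@sub_finite_set _ _ (f @` setT)%classic); last first.
  by apply: finite_image; exact: finite_finset.
move=> v [/= v0 [vdec vk] _ _].
have hmax i : v 0 ord_max <= v 0 i by apply: vdec; rewrite leq_ord.
have h0 i : v 0 i <= v 0 ord0 by apply: vdec.
have max_le0 : v 0 ord_max <= 0.
  rewrite leNgt; apply/negP => lt0.
  have: 0 < \sum_(i < n.+1) v 0 i.
    rewrite big_ord_recl ltr_wpDr ?(lt_le_trans lt0) ?hmax //.
    by apply: sumr_ge0 => i _; apply: le_trans (hmax _); exact: ltW.
  by rewrite v0 ltxx.
have ge0 : 0 <= v 0 ord0.
  rewrite leNgt; apply/negP => lt0.
  have: \sum_(i < n.+1) v 0 i < 0.
    rewrite big_ord_recl -[ltRHS]addr0 ltr_leD //.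
    by apply: sumr_le0 => i _; apply: le_trans (h0 _) _; exact: ltW.
  by rewrite v0 ltxx.
exists [ffun i => inord (absz (v 0 i + k%:Z))] => //.
apply/rowP => i; rewrite !mxE ffunE inordK; move: (hmax i) (h0 i); lia.
Qed.

(* Element of the rational group algebra of 'S_n.+1, as its family of
   coefficients. *)
Definition cellini (n k : nat) : {ffun 'S_n.+1 -> rat} :=
  [ffun w => (#|` fset_set (cellini_vectors k w)|)%:R / k%:R ^+ n].

Definition unif_prob (T : finType) (S : {set T}) (E : pred T) : rat :=
  #|[set x in S | E x]|%:R / #|S|%:R.

(* Main.v *)
Require Import Defs.
From mathcomp Require Import finmap boolp classical_sets cardinality.
From mathcomp Require Import all_boot all_order all_fingroup all_algebra.
From mathcomp Require Import all_solvable all_field mxred.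
From mathcomp Require Import zify ring.

Set Implicit Arguments.
Unset Strict Implicit.
Unset Printing Implicit Defensive.

(** Write q for the number of elements of F.

    The semisimple classes of SL(3, F) correspond, through the characteristic
    polynomial, to the q^2 cubics X^3 - a X^2 + b X - 1 (class_coefs_inj,
    class_coefs_onto). Over F, two semisimple matrices with the same cubic are
    similar: if the cubic splits, both are diagonalizable; otherwise both have
    a cyclic vector and are similar to the companion matrix
    (semisimple_similar). A conjugating matrix can be chosen of determinant 1,
    because the matrices that commute with a nonscalar semisimple matrix take
    all nonzero determinants (semisimple_centralizer_det). Conversely each
    cubic comes from a diagonal matrix or from a companion matrix, which is
    semisimple because a cubic with a repeated root in the closure splits
    (nonsplit_cubic_separable).

    The value of Phi only depends on the number k of roots in F of the cubic,
    counted with multiplicity: this is the number of parts 1 of the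
    factorization type, and a partition of 3 is determined by its parts 1. The
    conjugacy classes of S_3 are likewise determined by the number of fixed
    points, 3, 1 or 0 (Phi_cubic, class_S3_fixpts).

    It remains to compare two counts. Let g be the number of cube roots of 1 in
    F. Letting S_3 permute the triples of roots u, v, w with u v w = 1, the
    Cauchy-Frobenius formula yields
      6 N_3 = (q - 1)^2 + 3 (q - 1) + 2 g
    for the number N_3 of cubics with k = 3. The number of pairs of a cubic and
    one of its roots is q (q - 1), from which N_1 = q (q - 1) / 2
    (card_cubic_type). On the other side, Cellini's vectors for n = 3 are the
    pairs s = v_0 - v_2, b = v_1 - v_2 with 0 <= b <= s <= q and 3 dividing
    s + b, subject to strict inequalities that depend on the permutation. For
    the three transpositions together these pairs are counted by q (q - 1) / 2,
    for the identity by N_3, and for the whole group by q^2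
    (cellini_count_transp, cellini_count_id, cellini_count_cycle). *)

Import Order.TTheory GRing.Theory Num.Theory.
Local Open Scope ring_scope.

(** * Cellini's vectors for n = 3 *)

(** A vector v of sum 0 is determined by s = v_0 - v_2 and b = v_1 - v_2, and
    v_2 = - (s + b) / 3 has to be an integer. The booleans d1, d2 and d3 tell
    which of the three cyclic strict inequalities the permutation imposes. *)
Definition cellini_count (q : nat) (d1 d2 d3 : bool) : nat :=
  (\sum_(0 <= s < q.+1) \sum_(0 <= b < s.+1)
    [&& 3 %| s + b, d1 ==> (b < s), d2 ==> (0 < b) & d3 ==> (s < q)])%N.

Lemma card_cellini_vectors (q : nat) (w : 'S_3)
    (i0 := ord0 : 'I_3) (i1 := @Ordinal 3 1 isT) (i2 := ord_max : 'I_3) :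
  #|` fset_set (cellini_vectors q w)| =
  cellini_count q (w i1 < w i0)%N (w i2 < w i1)%N (w i0 < w i2)%N.
Proof.
set d1 := (w i1 < w i0)%N; set d2 := (w i2 < w i1)%N.
set d3 := (w i0 < w i2)%N.
pose E := [set x : 'I_q.+1 * 'I_q.+1 | [&& (x.2 <= x.1)%N, (3 %| x.1 + x.2)%N,
  d1 ==> (x.2 < x.1)%N, d2 ==> (0 < x.2)%N & d3 ==> (x.1 < q)%N]].
pose f (x : 'I_q.+1 * 'I_q.+1) : 'rV[int]_3 :=
  \row_(i < 3) (nth 0%N [:: (x.1 : nat); (x.2 : nat); 0%N] i)%:Z
  - const_mx (((x.1 + x.2) %/ 3)%N%:Z).
have val1 : i1 = 1%N :> nat by [].
have ordE (i : 'I_3) : [\/ i = i0, i = i1 | i = i2].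
  case: i => -[|[|[|//]]] lt; [apply: Or31|apply: Or32|apply: Or33];
  by apply: val_inj; rewrite /= ?val1.
have fE x i : f x 0 i = (nth 0%N [:: (x.1 : nat); (x.2 : nat); 0%N] i)%:Z
  - ((x.1 + x.2) %/ 3)%N%:Z by rewrite !mxE.
have sum3 (v : 'rV[int]_3) : \sum_(i < 3) v 0 i = v 0 i0 + v 0 i1 + v 0 i2.
  rewrite !big_ord_recl big_ord0 addr0 addrA; congr (_ + v 0 _ + v 0 _);
  by apply: val_inj; rewrite ?val1.
have f_inj : injective f.
  move=> [x1 x2] [y1 y2] /rowP fxy.
  have := (fxy i0, fxy i1, fxy i2); rewrite !fE !val1 /= => -[[h0 h1] h2].
  by congr (_, _); apply: val_inj => /=; lia.
have -> : fset_set (cellini_vectors q w) = [fset f x | x in E]%fset.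
  apply/fsetP => v; move: (v : 'rV[int]_3) => {}v.
  rewrite in_fset_set; last exact: finite_cellini_vectors.
  apply/idP/imfsetP => /=.
    rewrite in_setE /cellini_vectors /= => -[]; rewrite sum3.
    move=> v0 [vdec vk] vd ve.
    have h01 : v 0 i1 <= v 0 i0 by apply: vdec; rewrite val1.
    have h12 : v 0 i2 <= v 0 i1 by apply: vdec; rewrite val1.
    have hd1 : d1 -> v 0 i1 < v 0 i0 by apply: vd; rewrite val1.
    have hd2 : d2 -> v 0 i2 < v 0 i1 by apply: vd; rewrite val1.
    have {}ve : d3 -> v 0 i0 < v 0 i2 + q%:Z by exact: ve.
    have {}vk : v 0 i0 - v 0 i2 <= q%:Z by exact: vk.
    exists (inord (absz (v 0 i0 - v 0 i2)%R), inord (absz (v 0 i1 - v 0 i2)%R)).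
      by rewrite inE /= !inordK; lia.
    apply/rowP => i; rewrite fE /= !inordK; try lia.
    by case: (ordE i) => ->; rewrite ?val1 /=; lia.
  move=> [[x1 x2]]; rewrite in_setE /= => Ex ->.
  have g0 : f (x1, x2) 0 i0 = x1%:Z - ((x1 + x2) %/ 3)%N%:Z by rewrite fE.
  have g1 : f (x1, x2) 0 i1 = x2%:Z - ((x1 + x2) %/ 3)%N%:Z by rewrite fE val1.
  have g2 : f (x1, x2) 0 i2 = 0 - ((x1 + x2) %/ 3)%N%:Z by rewrite fE.
  move: (ltn_ord x1) Ex => /= lt1.
  rewrite inE /= => /and5P[h21 h3 hd1 hd2 hd3].
  rewrite /cellini_vectors /=; split.
  - by rewrite sum3 g0 g1 g2; lia.
  - split; last by rewrite g0 g2; lia.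
    by move=> i j; case: (ordE i) => ->; case: (ordE j) => ->;
       rewrite ?val1 ?g0 ?g1 ?g2 //=; lia.
  - move=> i j; case: (ordE i) => ->; case: (ordE j) => ->;
    rewrite ?val1 ?g0 ?g1 ?g2 //= => _ hw.
      by move: hd1; rewrite /d1 hw /=; lia.
    by move: hd2; rewrite /d2 hw /=; lia.
  - by move=> hw; move: hd3; rewrite /d3 g0 g2 hw /=; lia.
rewrite card_imfset //= -cardE.
rewrite -sum1_card big_mkcond /cellini_count /=.
transitivity (\sum_(s < q.+1) \sum_(b < q.+1) ((s, b) \in E : nat))%N.
  by rewrite pair_bigA /=; apply: eq_bigr => -[s b] _ /=; case: (_ \in E).
rewrite /cellini_count big_mkord; apply: eq_bigr => s _.
rewrite big_mkord.
rewrite (big_ord_widen q.+1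
  (fun b : nat => [&& 3 %| s + b, d1 ==> (b < s), d2 ==> (0 < b)
                     & d3 ==> (s < q)] : nat)%N) ?ltn_ord //.
rewrite [RHS]big_mkcond /=; apply: eq_bigr => b _.
by rewrite inE /= ltnS; case: (b <= s)%N.
Qed.

Definition cellini_row (s : nat) (d1 d2 : bool) : nat :=
  (\sum_(0 <= b < s.+1) [&& 3 %| s + b, d1 ==> (b < s) & d2 ==> (0 < b)])%N.

Lemma cellini_count_row q d1 d2 d3 :
  cellini_count q d1 d2 d3 =
  (\sum_(0 <= s < if d3 then q else q.+1) cellini_row s d1 d2)%N.
Proof.
rewrite /cellini_count; case: d3; last first.
  by apply: eq_bigr => s _; apply: eq_bigr => b _; rewrite !andbT.
rewrite big_nat_recr //= [X in (_ + X)%N]big1 ?addn0; last first.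
  by move=> b _; rewrite ltnn !andbF.
apply: eq_big_nat => s /andP[_ ltsq]; apply: eq_bigr => b _.
by rewrite ltsq !andbT.
Qed.

Lemma sum_dvd3 n r :
  (\sum_(0 <= b < n) (3 %| r + b) = (n + 2 - (3 - r %% 3) %% 3) %/ 3)%N.
Proof.
elim: n => [|n IHn]; first by rewrite big_nil; lia.
by rewrite big_nat_recr //= IHn; lia.
Qed.

Lemma cellini_row00 s :
  cellini_row s false false = ((s + 3 - (3 - s %% 3) %% 3) %/ 3)%N.
Proof.
rewrite -[(s + 3)%N]addSnnS -sum_dvd3.
by apply: eq_bigr => b _; rewrite andbT.
Qed.

Lemma cellini_row10 s :
  cellini_row s true false = ((s + 2 - (3 - s %% 3) %% 3) %/ 3)%N.
Proof.
rewrite -sum_dvd3 /cellini_row big_nat_recr //= ltnn andbF addn0.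
by apply: eq_big_nat => b /andP[_ ->]; rewrite !andbT.
Qed.

Lemma cellini_row01 s :
  cellini_row s false true = ((s + 2 - (3 - s.+1 %% 3) %% 3) %/ 3)%N.
Proof.
rewrite -sum_dvd3 /cellini_row big_nat_recl //= andbF add0n.
by apply: eq_bigr => b _; rewrite andbT addSnnS.
Qed.

Lemma cellini_row11 s :
  cellini_row s.+1 true true = ((s + 2 - (3 - s.+2 %% 3) %% 3) %/ 3)%N.
Proof.
rewrite -sum_dvd3 /cellini_row big_nat_recl //= andbF add0n.
rewrite big_nat_recr //= ltnn andbF addn0.
by apply: eq_big_nat => b /andP[_ lt]; rewrite ltnS lt !andbT addnS.
Qed.

(** From q to q + 1 the three counts grow by one row each. After a shift of b
    these rows run over the same q values of b, with 3 dividing q + b, q + b + 1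
    and q + b + 2 respectively; together they count each b once. *)
Lemma cellini_count_transp q :
  (2 * (cellini_count q true false true + cellini_count q false true true +
        cellini_count q true true false) = q * q.-1)%N.
Proof.
rewrite !cellini_count_row /=.
elim: q => [|q IHq].
  by rewrite !big_nil big_nat1 /cellini_row big_nat1.
rewrite !(big_nat_recr q) ?(big_nat_recr q.+1) //=.
rewrite cellini_row10 cellini_row01 cellini_row11.
move: IHq; set A := (\sum_(0 <= i < q) _)%N; set B := (\sum_(0 <= i < q.+1) _)%N.
by case: q @A @B => [|q] A B; lia.
Qed.

(** As for transpositions, the rows that are added share out q + 1 values of b
    according to their residue modulo 3. *)
Lemma cellini_count_cycle q :
  (2 * (cellini_count q false false true + cellini_count q false true false +
        cellini_count q true false false) = q * q.+1)%N.
Proof.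
rewrite !cellini_count_row /=.
elim: q => [|q IHq].
  by rewrite !big_nil !big_nat1 /cellini_row !big_nat1.
rewrite !(big_nat_recr q) //= !(big_nat_recr q.+1) //=.
rewrite cellini_row00 cellini_row10 cellini_row01.
move: IHq; set A := (\sum_(0 <= i < q) _)%N.
set B := (\sum_(0 <= i < q.+1) _)%N; set C := (\sum_(0 <= i < q.+1) _)%N.
lia.
Qed.

(** The residue classes modulo 3 are equally represented unless 3 divides
    q - 1. The conditional is the number of cube roots of 1 in a field with
    q elements. *)
Lemma cellini_count_id q : (0 < q)%N ->
  (6 * cellini_count q false false true + 2 =
   q * q.+1 + 2 * (if 3 %| q.-1 then 3 else 1))%N.
Proof.
case: q => // q _; rewrite cellini_count_row /=.
elim: q => [|q IHq]; first by rewrite big_nat1 /cellini_row big_nat1.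
rewrite big_nat_recr //= cellini_row00.
move: IHq; set A := (\sum_(0 <= i < q.+1) _)%N.
by case: ifP; case: ifP; lia.
Qed.

(** * Cubics with constant term -1 *)

(** The characteristic polynomials of the 3 x 3 matrices of determinant 1. *)
Definition cubic (F : fieldType) (c : F * F) : {poly F} :=
  Poly [:: -1; c.2; - c.1; 1].

Section Cubic.
Variable F : fieldType.
Implicit Types (c : F * F) (u v w x : F) (p : {poly F}).

Lemma cubic_seq c : cubic c = [:: -1; c.2; - c.1; 1] :> seq F.
Proof. by rewrite /cubic (@PolyK _ 0) ?oner_neq0. Qed.

Lemma size_cubic c : size (cubic c) = 4%N.
Proof. by rewrite cubic_seq. Qed.

Lemma cubic_monic c : cubic c \is monic.
Proof. by rewrite monicE lead_coefE cubic_seq. Qed.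

Lemma cubic_neq0 c : cubic c != 0.
Proof. exact/monic_neq0/cubic_monic. Qed.

Lemma cubicE c : cubic c = 'X^3 - c.1%:P * 'X^2 + c.2%:P * 'X - 1.
Proof.
by rewrite /cubic /= !cons_poly_def !polyCN polyC1; ring.
Qed.

Lemma horner_cubic c x : (cubic c).[x] = x ^+ 3 - c.1 * x ^+ 2 + c.2 * x - 1.
Proof. by rewrite cubicE !hornerE. Qed.

Lemma cubic_coef p : p \is monic -> size p = 4%N -> p`_0 = -1 ->
  p = cubic (- p`_2, p`_1).
Proof.
move=> /monicP; rewrite lead_coefE => p3 sp p0; move: p3; rewrite sp /= => p3.
apply/polyP => i; rewrite cubic_seq /=.
case: i => [|[|[|[|i]]]] //=; first by rewrite opprK.
by rewrite !nth_default ?sp.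
Qed.

Lemma cubic_inj : injective (@cubic F).
Proof.
move=> [a b] [a' b'] /(congr1 (@polyseq F)); rewrite !cubic_seq /=.
by case=> -> /oppr_inj ->.
Qed.

(** The coefficients of the cubic with roots x.1, x.2 and (x.1 * x.2)^-1. *)
Definition cubic_of_roots (x : F * F) : F * F :=
  (x.1 + x.2 + (x.1 * x.2)^-1,
   x.1 * x.2 + (x.1 + x.2) * (x.1 * x.2)^-1).

Definition nz_pair : pred (F * F) := [pred x | (x.1 != 0) && (x.2 != 0)].

Lemma prod_cubic_of_roots (x : F * F) : nz_pair x ->
  cubic (cubic_of_roots x) =
    \prod_(y <- [:: x.1; x.2; (x.1 * x.2)^-1]) ('X - y%:P).
Proof.
case: x => x y /andP[/= x0 y0]; rewrite cubicE !big_cons big_nil mulr1 /=.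
have e1 : 1 = x%:P * y%:P * (x * y)^-1%:P :> {poly F}.
  by rewrite -!polyCM mulfV ?mulf_neq0.
by rewrite [X in _ - X]e1 !(polyCD, polyCM); ring.
Qed.

Lemma cubic_prodP c u v w : cubic c = \prod_(y <- [:: u; v; w]) ('X - y%:P) ->
  [/\ nz_pair (u, v), w = (u * v)^-1 & c = cubic_of_roots (u, v)].
Proof.
move=> def_c; have uvw1 : u * v * w = 1.
  have := congr1 (horner^~ 0) def_c.
  rewrite horner_cubic !big_cons big_nil mulr1 !hornerE /= ?expr0n /= => e.
  have -> : u * v * w = - (- u * - v * - w) by ring.
  by rewrite -e; ring.
have uv0 : u * v != 0.
  by apply: contra_eq_neq uvw1 => ->; rewrite mul0r eq_sym oner_neq0.
have w_def : w = (u * v)^-1 by apply: (mulfI uv0); rewrite uvw1 mulfV.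
have nz : nz_pair (u, v) by rewrite /nz_pair /= -negb_or -mulf_eq0.
split=> //; apply: cubic_inj.
by rewrite prod_cubic_of_roots // -w_def.
Qed.

Lemma cubic_of_roots_eq (x y : F * F) : nz_pair x -> nz_pair y ->
  (cubic_of_roots x == cubic_of_roots y) =
  perm_eq [:: x.1; x.2; (x.1 * x.2)^-1] [:: y.1; y.2; (y.1 * y.2)^-1].
Proof.
move=> nx ny; apply/eqP/idP => [e|e].
  by apply: prod_XsubC_eq; rewrite -!prod_cubic_of_roots ?e.
by apply: cubic_inj; rewrite !prod_cubic_of_roots //; apply: perm_big.
Qed.

Lemma monic_size2 (p : {poly F}) : p \is monic -> size p = 2%N ->
  p = 'X - (- p`_0)%:P.
Proof.
move=> /monicP; rewrite lead_coefE => p1 sp; move: p1; rewrite sp /= => p1.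
apply/polyP => -[|[|i]]; rewrite coefB coefX coefC /= ?p1 ?subr0 ?sub0r ?opprK //.
by rewrite nth_default ?sp.
Qed.

Lemma root_monic_factor (p : {poly F}) u : p \is monic -> root p u ->
  exists r, [/\ r \is monic, p = ('X - u%:P) * r & size p = (size r).+1].
Proof.
move=> p_mon /factor_theorem[r def_p]; have r_mon : r \is monic.
  by rewrite -(monicMr _ (monicXsubC u)) -def_p.
exists r; split; rewrite // def_p; first exact: mulrC.
by rewrite size_Mmonic ?monicXsubC ?(monic_neq0 r_mon) // size_XsubC addnC.
Qed.

End Cubic.

(** * Counting cubics by factorization type *)

Section CubicCount.
Variable F : finFieldType.
Implicit Types (c : F * F) (x y z u v : F).

Definition ordered_roots (x y z : F) : seq (F * F) :=
  [:: (x, y); (x, z); (y, x); (y, z); (z, x); (z, y)].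

Definition cube_roots1 : {set F} := [set u | u ^+ 3 == 1].

(** Two cubics are equal when their roots agree up to order, so that the fibre
    of cubic_of_roots consists of the orderings of the roots; two of them
    determine the third. *)
Lemma ordered_rootsP x y (w : F * F) : nz_pair (x, y) ->
  nz_pair w && (cubic_of_roots w == cubic_of_roots (x, y)) =
  (w \in ordered_roots x y (x * y)^-1).
Proof.
set z := (x * y)^-1 => nz; have /andP[/= x0 y0] := nz.
have z0 : z != 0 by rewrite invr_eq0 mulf_neq0.
have xyz : x * y * z = 1 by rewrite mulfV ?mulf_neq0.
have inv3 (a b d : F) : a * b * d = 1 -> (a * b)^-1 = d.
  move=> abd; have ab0 : a * b != 0.
    by apply: contra_eq_neq abd => ->; rewrite mul0r eq_sym oner_neq0.
  by rewrite -[d](mulKf ab0) abd mulr1.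
apply/andP/idP => [[nw]|].
  rewrite cubic_of_roots_eq //= -/z; case: w nw => a b /= _.
  have two s t t' : perm_eq [:: b; s] [:: t; t'] -> b = t \/ b = t'.
    by move/perm_mem/(_ b); rewrite !inE eqxx /= => /esym/orP[] /eqP; [left|right].
  move=> pe; have := perm_mem pe a; rewrite !inE eqxx /= => /esym/or3P[] /eqP ea;
    subst a.
  - by move: pe; rewrite perm_cons => /two[]->; rewrite eqxx ?orbT.
  - move: pe; have /permPr-> : perm_eq [:: x; y; z] [:: y; x; z].
      by apply/seq.permP => P /=; lia.
    by rewrite perm_cons => /two[]->; rewrite eqxx ?orbT.
  - move: pe; have /permPr-> : perm_eq [:: x; y; z] [:: z; x; y].
      by apply/seq.permP => P /=; lia.
    by rewrite perm_cons => /two[]->; rewrite eqxx ?orbT.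
move=> w_in; have nw : nz_pair w.
  by move: w_in; rewrite !inE => /or4P[| | |/or3P[]] /eqP->;
     rewrite /nz_pair /= ?x0 ?y0 ?z0.
split=> //; rewrite cubic_of_roots_eq //=.
rewrite -/z; move: w_in; rewrite !inE => /or4P[| | |/or3P[]] /eqP-> /=.
- by rewrite -/z.
- by rewrite (inv3 _ _ y); [apply/seq.permP => P /=; lia | rewrite -xyz; ring].
- by rewrite (inv3 _ _ z); [apply/seq.permP => P /=; lia | rewrite -xyz; ring].
- by rewrite (inv3 _ _ x); [apply/seq.permP => P /=; lia | rewrite -xyz; ring].
- by rewrite (inv3 _ _ y); [apply/seq.permP => P /=; lia | rewrite -xyz; ring].
- by rewrite (inv3 _ _ x); [apply/seq.permP => P /=; lia | rewrite -xyz; ring].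
Qed.

(** The Cauchy-Frobenius count of the single orbit of S_3 on the orderings of
    x, y, z: the identity fixes all of them, and a transposition and a 3-cycle
    fix those with a repeated entry u, respectively with three entries u. The
    second equation counts x, y and z with multiplicity. *)
Lemma card_ordered_roots x y z : x * y * z = 1 ->
  let D := [set u | (u, u) \in ordered_roots x y z] in
  (#|[set w in ordered_roots x y z]| + 3 * #|D| + 2 * #|cube_roots1 :&: D| = 6 /\
   #|[set u in [:: x; y; z]]| + #|D| + #|cube_roots1 :&: D| = 3)%N.
Proof.
have two_eq a b : a * a * b = 1 -> a != b ->
    let D := [set u | (u, u) \in ordered_roots a a b] in
    (#|[set w in ordered_roots a a b]| + 3 * #|D| + 2 * #|cube_roots1 :&: D| = 6 /\
     #|[set u in [:: a; a; b]]| + #|D| + #|cube_roots1 :&: D| = 3)%N.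
  move=> aab ab D.
  have -> : [set w in ordered_roots a a b] =
      [set w in [:: (a, a); (a, b); (b, a)]].
    by apply/setP => w; rewrite !inE; do 3! case: (w == _).
  have DE : D = [set a].
    apply/setP => u; rewrite !inE !xpair_eqE; case: eqVneq => [->|_] //=.
    by rewrite !andbF.
  have EE : cube_roots1 :&: D = set0.
    apply/setP => u; rewrite DE !inE; case: (eqVneq u a) => [->|_] /=;
      last by rewrite !andbF.
    rewrite andbT; apply/eqP => a3; case/eqP: ab.
    have aa0 : a * a != 0.
      by apply: contra_eq_neq aab => ->; rewrite mul0r eq_sym oner_neq0.
    by apply: (mulfI aa0); rewrite aab -a3; ring.
  have RE : [set u in [:: a; a; b]] = [set a; b].
    by apply/setP => u; rewrite !inE orbA orbb.
  rewrite EE DE RE cards2 ab cards1 cards0 cardsE.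
  rewrite (card_uniqP _) //= !inE !xpair_eqE.
  by rewrite eqxx (negPf ab).
move=> xyz D.
have [exy|nxy] := eqVneq x y.
  subst y; have [exz|nxz] := eqVneq x z; last exact: two_eq.
  subst z.
  have -> : [set w in ordered_roots x x x] = [set (x, x)].
    by apply/setP => w; rewrite !inE; case: (w == _).
  have DE : D = [set x].
    by apply/setP => u; rewrite !inE !xpair_eqE; case: (u == x).
  have -> : cube_roots1 :&: D = [set x].
    apply/setP => u; rewrite DE !inE; case: (eqVneq u x) => [->|_];
      rewrite ?andbF //.
    by rewrite -xyz !exprS expr0 mulr1 mulrA eqxx.
  have -> : [set u in [:: x; x; x]] = [set x].
    by apply/setP => u; rewrite !inE !orbb.
  by rewrite DE !cards1.
have [exz|nxz] := eqVneq x z.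
  have -> : D = [set u | (u, u) \in ordered_roots x z y].
    by apply/setP => u; rewrite !inE; do 6! case: (_ == _).
  have -> : [set w in ordered_roots x y z] = [set w in ordered_roots x z y].
    by apply/setP => w; rewrite !inE; do 6! case: (w == _).
  have -> : [set u in [:: x; y; z]] = [set u in [:: x; z; y]].
    by apply/setP => u; rewrite !inE; do 3! case: (u == _).
  by subst z; apply: two_eq => //; rewrite -xyz; ring.
have [eyz|nyz] := eqVneq y z.
  have -> : D = [set u | (u, u) \in ordered_roots y z x].
    by apply/setP => u; rewrite !inE; do 6! case: (_ == _).
  have -> : [set w in ordered_roots x y z] = [set w in ordered_roots y z x].
    by apply/setP => w; rewrite !inE; do 6! case: (w == _).
  have -> : [set u in [:: x; y; z]] = [set u in [:: y; z; x]].
    by apply/setP => u; rewrite !inE; do 3! case: (u == _).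
  by subst z; apply: two_eq; [rewrite -xyz; ring|rewrite eq_sym].
have no u : ((u, u) \in ordered_roots x y z) = false.
  rewrite !inE !xpair_eqE; case: (eqVneq u x) => [->|_] /=.
    by rewrite (negPf nxy) (negPf nxz) !andbF.
  by case: (eqVneq u y) => [->|_] /=; rewrite ?andbF ?(negPf nyz).
have DE : D = set0 by apply/setP => u; rewrite inE no inE.
rewrite DE setI0 cards0 !cardsE !(card_uniqP _) //= !inE ?xpair_eqE ?eqxx.
  by rewrite (negPf nxy) (negPf nxz) (negPf nyz).
rewrite !(eq_sym y x) !(eq_sym z x) !(eq_sym z y).
by rewrite (negPf nxy) (negPf nxz) (negPf nyz).
Qed.

Definition total_mup (p : {poly F}) : nat := (\sum_(u : F) mup u p)%N.

Lemma total_mupM (p q : {poly F}) : p != 0 -> q != 0 ->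
  total_mup (p * q) = (total_mup p + total_mup q)%N.
Proof.
by move=> p0 q0; rewrite -big_split; apply: eq_bigr => u _; exact: mupM.
Qed.

Lemma total_mup_noroot (p : {poly F}) :
  (forall u, ~~ root p u) -> total_mup p = 0%N.
Proof. by move=> nor; apply: big1 => u _; rewrite mupNroot. Qed.

Lemma total_mup_XsubC u : total_mup ('X - u%:P) = 1%N.
Proof.
rewrite /total_mup (bigD1 u) //= big1 => [|v vu].
  by rewrite -['X - _]expr1 mup_XsubCX eqxx.
by rewrite mupNroot // root_XsubC.
Qed.

Lemma total_mup_prod_XsubC (s : seq F) :
  total_mup (\prod_(x <- s) ('X - x%:P)) = size s.
Proof.
elim: s => [|x s IHs].
  by rewrite big_nil total_mup_noroot // => u; rewrite root1.
rewrite big_cons total_mupM ?IHs ?total_mup_XsubC ?polyXsubC_eq0 //.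
by apply: monic_neq0; apply: monic_prod => i _; apply: monicXsubC.
Qed.

Definition split_cubic c := [exists w, nz_pair w && (cubic_of_roots w == c)].

Lemma split_cubicP c :
  reflect (exists u v w, cubic c = \prod_(y <- [:: u; v; w]) ('X - y%:P))
          (split_cubic c).
Proof.
apply: (iffP existsP) => [[w /andP[nw /eqP<-]]|[u [v [w def_c]]]].
  by exists w.1, w.2, (w.1 * w.2)^-1; apply: prod_cubic_of_roots.
by have [nz _ ->] := cubic_prodP def_c; exists (u, v); rewrite nz eqxx.
Qed.

(** Two roots, counted with multiplicity, force the third. *)
Lemma nonsplit_cubic_factor c u : ~~ split_cubic c -> root (cubic c) u ->
  exists r, [/\ r \is monic, size r = 3%N, cubic c = ('X - u%:P) * r &
                forall v, ~~ root r v].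
Proof.
move=> nsplit /(root_monic_factor (cubic_monic c))[r [r_mon def_c]].
rewrite size_cubic => -[sr]; exists r; split=> // v.
apply: contra nsplit => /(root_monic_factor r_mon)[t [t_mon def_r]].
rewrite -sr => -[st]; apply/split_cubicP; exists u, v, (- t`_0).
by rewrite !big_cons big_nil mulr1 -monic_size2 // -def_r.
Qed.

Lemma total_mup_split c : split_cubic c -> total_mup (cubic c) = 3%N.
Proof. by case/split_cubicP=> u [v [w ->]]; rewrite total_mup_prod_XsubC. Qed.

Lemma card_roots_nonsplit c : ~~ split_cubic c ->
  [/\ #|[set u | root (cubic c) u]| = total_mup (cubic c) &
      (total_mup (cubic c) <= 1)%N].
Proof.
move=> nsplit; case: (set_0Vmem [set u | root (cubic c) u]) => [R0|[u]].
  rewrite R0 cards0 total_mup_noroot // => u.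
  by apply/negP => cu; have := in_set0 u; rewrite -R0 inE cu.
rewrite inE => /(nonsplit_cubic_factor nsplit)[r [r_mon sr def_c no_r]].
have -> : [set u | root (cubic c) u] = [set u].
  apply/setP => v; rewrite !inE def_c rootM root_XsubC (negPf (no_r v)) orbF.
  by rewrite eq_sym.
rewrite cards1 def_c total_mupM ?polyXsubC_eq0 ?monic_neq0 //.
by rewrite total_mup_XsubC total_mup_noroot.
Qed.

Let Fu : {set F} := [set u | u != 0].
Let fiberO c := [set w | nz_pair w && (cubic_of_roots w == c)].
Let fiberD c := [set u in Fu | cubic_of_roots (u, u) == c].
Let fiberE c := [set u in cube_roots1 | cubic_of_roots (u, u) == c].

Lemma cube_roots1_neq0 u : u \in cube_roots1 -> u != 0.
Proof.
by rewrite inE; apply: contraTneq => ->; rewrite expr0n eq_sym oner_eq0.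
Qed.

(** The three fibres are the orderings of the roots of the cubic that are fixed
    by the identity, by a transposition and by a 3-cycle of S_3. They are empty
    unless all roots lie in F. *)
Lemma cubic_burnside c :
  (#|fiberO c| + 3 * #|fiberD c| + 2 * #|fiberE c| =
     6 * (total_mup (cubic c) == 3) /\
   #|[set u | root (cubic c) u]| + #|fiberD c| + #|fiberE c| =
     (total_mup (cubic c) == 1) + 3 * (total_mup (cubic c) == 3))%N.
Proof.
have [split|nsplit] := boolP (split_cubic c); last first.
  have [-> le1] := card_roots_nonsplit nsplit.
  have O0 w : nz_pair w && (cubic_of_roots w == c) = false.
    by apply: contraNF nsplit => cw; apply/existsP; exists w.
  have -> : fiberO c = set0 by apply/setP => w; rewrite !inE O0.
  have D0 u : u != 0 -> (cubic_of_roots (u, u) == c) = false.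
    by move=> u0; rewrite -(O0 (u, u)) /nz_pair /= u0.
  have -> : fiberD c = set0.
    by apply/setP => u; rewrite !inE; case: eqVneq => //= /D0.
  have -> : fiberE c = set0.
    apply/setP => u; rewrite !inE; apply/negbTE/andP => -[u3].
    by rewrite D0 // cube_roots1_neq0 ?inE.
  by rewrite !cards0; case: (total_mup _) le1 => [|[]].
rewrite total_mup_split //=.
case/existsP: split => -[x y] /andP[nz /eqP def_c].
have Lin w := ordered_rootsP w nz.
have Lu u : u != 0 -> (cubic_of_roots (u, u) == c) =
    ((u, u) \in ordered_roots x y (x * y)^-1).
  by move=> u0; rewrite -Lin /nz_pair /= u0 def_c.
have xyz : x * y * (x * y)^-1 = 1.
  by rewrite mulfV // mulf_neq0 //; case/andP: nz.
have -> : fiberO c = [set w in ordered_roots x y (x * y)^-1].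
  by apply/setP => w; rewrite [LHS]inE [RHS]inE -def_c Lin.
have no0 : (0, 0) \in ordered_roots x y (x * y)^-1 = false.
  by rewrite -Lin /nz_pair /= eqxx.
have -> : fiberD c = [set u | (u, u) \in ordered_roots x y (x * y)^-1].
  apply/setP => u; rewrite [LHS]inE [u \in Fu]inE [RHS]inE.
  by have [->|/Lu->] := eqVneq u 0; rewrite ?no0.
have -> : fiberE c = cube_roots1 :&:
    [set u | (u, u) \in ordered_roots x y (x * y)^-1].
  apply/setP => u; rewrite [LHS]inE [RHS]inE [u \in [set _ | _]]inE.
  by case: (boolP (u \in cube_roots1)) => //= /cube_roots1_neq0/Lu->.
have -> : [set u | root (cubic c) u] = [set u in [:: x; y; (x * y)^-1]].
  apply/setP => u; rewrite !inE -def_c prod_cubic_of_roots //.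
  by rewrite root_prod_XsubC !inE.
exact: card_ordered_roots.
Qed.

Lemma sum_card_fibers (T1 T2 : finType) (A : {set T1}) (f : T1 -> T2) :
  (\sum_(y : T2) #|[set x in A | f x == y]| = #|A|)%N.
Proof.
rewrite -[RHS]sum1_card (partition_big f xpredT) //=; apply: eq_bigr => y _.
by rewrite -sum1_card; apply: eq_bigl => x; rewrite inE.
Qed.

Lemma card_nonzero : #|Fu| = #|F|.-1.
Proof.
by rewrite -(cardC1 (0 : F)); apply: eq_card => u; rewrite !inE.
Qed.

(** Given a root u, which is nonzero, the coefficient of X^2 is arbitrary and
    determines the coefficient of X. *)
Lemma sum_card_roots :
  (\sum_(c : F * F) #|[set u | root (cubic c) u]| = #|F| * #|F|.-1)%N.
Proof.
transitivity (\sum_(u : F) #|[set c : F * F | root (cubic c) u]|)%N.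
  under eq_bigr do rewrite -sum1dep_card big_mkcond.
  by rewrite exchange_big /=; under eq_bigr do rewrite -big_mkcond sum1dep_card.
rewrite (bigD1 0) //= [X in (X + _)%N](_ : _ = 0%N) ?add0n; last first.
  apply/eqP; rewrite cards_eq0; apply/eqP/setP => c.
  rewrite !inE rootE horner_cubic !expr0n !mulr0 subr0 addr0 sub0r.
  by rewrite oppr_eq0 oner_eq0.
have card_u u : u != 0 -> #|[set c : F * F | root (cubic c) u]| = #|F|.
  move=> u0; pose f a : F * F := (a, (1 - u ^+ 3 + a * u ^+ 2) / u).
  have f_inj : injective f by move=> a a' [].
  rewrite -(card_codom f_inj); apply: eq_card => -[a b]; rewrite inE.
  rewrite rootE horner_cubic /=; apply/eqP/codomP => [e|[a' [-> ->]]].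
    exists a; congr (_, _); apply: (mulIf u0); rewrite mulfVK //.
    by apply/eqP; rewrite -subr_eq0 -[X in _ == X]e; apply/eqP; ring.
  by rewrite divfK //; ring.
rewrite (eq_bigr (fun=> #|F|)) // sum_nat_const mulnC; congr (_ * _)%N.
by rewrite -card_nonzero; apply: eq_card => u; rewrite !inE.
Qed.

Definition num_cubics (s : nat) : nat :=
  #|[set c : F * F | total_mup (cubic c) == s]|.

(** Summing the local counts over all cubics: a pair of nonzero roots, a
    nonzero double root or a cube root of 1 determines the cubic. *)
Lemma card_cubic_type :
  (6 * num_cubics 3 =
     #|F|.-1 * #|F|.-1 + 3 * #|F|.-1 + 2 * #|cube_roots1| /\
   num_cubics 1 + 3 * num_cubics 3 =
     #|F| * #|F|.-1 + #|F|.-1 + #|cube_roots1|)%N.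
Proof.
have NE s : num_cubics s = (\sum_(c : F * F) (total_mup (cubic c) == s))%N.
  rewrite /num_cubics -sum1dep_card big_mkcond.
  by apply: eq_bigr => c _; case: eqP.
have sO : (\sum_c #|fiberO c| = #|F|.-1 * #|F|.-1)%N.
  rewrite -card_nonzero -cardsX -(sum_card_fibers _ (@cubic_of_roots F)).
  by apply: eq_bigr => c _; apply: eq_card => w; rewrite !inE.
have sD : (\sum_c #|fiberD c| = #|F|.-1)%N.
  by rewrite -card_nonzero -(sum_card_fibers _ (fun u => cubic_of_roots (u, u))).
have sE : (\sum_c #|fiberE c| = #|cube_roots1|)%N.
  by rewrite -(sum_card_fibers _ (fun u => cubic_of_roots (u, u))).
rewrite !NE; split.
  rewrite -sO -{1}sD -sE !big_distrr -!big_split /=.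
  by apply: eq_bigr => c _; case: (cubic_burnside c).
rewrite -sum_card_roots -sD -sE !big_distrr -!big_split /=.
by apply: eq_bigr => c _; case: (cubic_burnside c).
Qed.

Lemma sum_num_cubics :
  (num_cubics 0 + num_cubics 1 + num_cubics 3 = #|F| * #|F|)%N.
Proof.
rewrite -card_prod -sum1_card /num_cubics -!sum1dep_card.
rewrite !(big_mkcond (fun c => total_mup (cubic c) == _)) -!big_split /=.
apply: eq_bigr => c _; have [/total_mup_split->//|] := boolP (split_cubic c).
by case/card_roots_nonsplit=> _; case: (total_mup _) => [|[]].
Qed.

Lemma card_cube_roots1 :
  #|cube_roots1| = (if 3 %| #|F|.-1 then 3 else 1)%N.
Proof.
have [div3|ndiv3] := boolP (3 %| #|F|.-1)%N; last first.
  have -> : cube_roots1 = [set 1]; last exact: cards1.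
  apply/setP => u; rewrite !inE; apply/eqP/eqP => [u3|->]; last exact: expr1n.
  have u0 : u != 0 by apply: cube_roots1_neq0; rewrite inE u3.
  have uq : u ^+ #|F|.-1 = 1.
    rewrite -[_ ^+ _](mulKf u0) -exprS prednK ?expf_card ?mulVf //.
    exact: ltnW (finNzRing_gt1 F).
  move: uq; rewrite (divn_eq #|F|.-1 3) exprD mulnC exprM u3 expr1n mul1r.
  have : (#|F|.-1 %% 3 < 3)%N by rewrite ltn_mod.
  move: ndiv3; rewrite /dvdn; case: (_ %% 3)%N => [|[|[|]]] // _ _ u2.
  by move: u3; rewrite exprS u2 mulr1.
have : (3 %| #|[set: {unit F}]|)%N by rewrite card_finField_unit.
case/Cauchy=> // g _ og; have g3 : val g ^+ 3 = 1.
  by rewrite -FinRing.val_unitX -og expg_order.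
have g1 : val g != 1.
  apply/eqP => g1; have : g == 1%g by apply/eqP/val_inj.
  by rewrite -order_eq1 og.
move: (val g) g3 g1 => w g3 g1 {og}.
have w_poly : w ^+ 2 + w + 1 = 0.
  have /eqP : (w - 1) * (w ^+ 2 + w + 1) = 0.
    have -> : (w - 1) * (w ^+ 2 + w + 1) = w ^+ 3 - 1 by ring.
    by rewrite g3 subrr.
  by rewrite mulf_eq0 subr_eq0 (negPf g1) => /eqP.
have -> : cube_roots1 = [set u in [:: 1; w; w ^+ 2]].
  apply/setP => u; rewrite [LHS]inE [RHS]inE !in_cons in_nil orbF.
  have fact : (u - 1) * ((u - w) * (u - w ^+ 2)) = u ^+ 3 - 1.
    have -> : (u - w) * (u - w ^+ 2) =
      u ^+ 2 - (w ^+ 2 + w + 1) * u + u + w ^+ 3 by ring.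
    by rewrite w_poly g3; ring.
  by rewrite -subr_eq0 -fact !mulf_eq0 !subr_eq0.
rewrite cardsE; apply/card_uniqP; rewrite /= !inE !andbT.
have w0 : w != 0 by apply: contra_eq_neq g3 => ->; rewrite expr0n eq_sym oner_eq0.
apply/andP; split; last first.
  by apply: contra g1 => /eqP e; rewrite -(mulKf w0 w) -expr2 -e mulVf.
rewrite negb_or eq_sym g1; apply: contra g1 => /eqP e.
by rewrite -g3 exprS -e mulr1.
Qed.

End CubicCount.

(** * Cycle types and factorization types *)

Section CycleType.
Variable T : finType.
Implicit Types (w : {perm T}) (x y : T).

Definition fixpts w : {set T} := [set x | w x == x].

Lemma porbit_fix w x : w x = x -> porbit w x = [set x].
Proof.
move=> wx; apply/setP => y; rewrite inE; apply/porbitP/eqP => [[i ->]|->].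
  by rewrite permX; elim: i => //= i ->.
by exists 0%N; rewrite perm1.
Qed.

Lemma count1_cycle_type w : count_mem 1%N (cycle_type w) = #|fixpts w|.
Proof.
rewrite /cycle_type count_map -size_filter -(card_imset _ (@set1_inj T)).
rewrite cardE; apply/perm_size/uniq_perm => [||B]; try exact: enum_uniq.
  by apply: filter_uniq; exact: enum_uniq.
rewrite mem_filter !mem_enum /=; apply/andP/imsetP => [[B1 /imsetP[x _ def_B]]|].
  have [y By] := cards1P B1; exists y => //; rewrite inE.
  have xB : x \in B by rewrite def_B porbit_id.
  have wxB : w x \in B by rewrite def_B; apply: (mem_porbit w 1).
  by move: xB wxB; rewrite By !inE => /eqP<- /eqP->.
case=> x; rewrite inE => /eqP wx ->; split; first by rewrite cards1.
by apply/imsetP; exists x; rewrite ?porbit_fix.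
Qed.

Lemma sumn_cycle_type w : sumn (cycle_type w) = #|T|.
Proof.
rewrite sumnE big_map big_enum /= -[RHS]sum1_card.
rewrite (partition_big (porbit w) (mem (porbits w))) /=; last first.
  by move=> x _; apply: imset_f.
apply: eq_bigr => B /imsetP[y _ ->]; rewrite -sum1_card; apply: eq_bigl => x.
by rewrite eq_porbit_mem.
Qed.

Lemma cycle_type_gt0 w : all (leq 1) (cycle_type w).
Proof.
apply/allP => k /mapP[B]; rewrite mem_enum => /imsetP[x _ ->] ->.
by rewrite lt0n card_porbit_neq0.
Qed.

End CycleType.

(** The partitions of 3, namely 3, 2+1 and 1+1+1, have different numbers of
    parts 1. *)
Lemma partition3_perm_eq (s t : seq nat) :
  all (leq 1) s -> all (leq 1) t -> sumn s = 3%N -> sumn t = 3%N ->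
  count_mem 1%N s = count_mem 1%N t -> perm_eq s t.
Proof.
have norm r : all (leq 1) r -> sumn r = 3%N ->
    exists2 r', perm_eq r r' & r' \in [:: [:: 3]; [:: 1; 2]; [:: 1; 1; 1]]%N.
  case: r => [|a [|b [|c [|d r]]]] //= r0 sr.
  - by exists [:: 3]%N; rewrite ?inE // (_ : a = 3%N) //; lia.
  - exists [:: 1; 2]%N; rewrite ?inE //.
    by have [[-> ->]|[-> ->]] : (a = 1 /\ b = 2 \/ a = 2 /\ b = 1)%N by lia.
  - exists [:: 1; 1; 1]%N; rewrite ?inE //.
    by have [-> [-> ->]] : (a = 1 /\ b = 1 /\ c = 1)%N by lia.
  - by exfalso; lia.
move=> s0 t0 /(norm s s0)[s' ss' s'_in] /(norm t t0)[t' tt' t'_in].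
move/seq.permP: (ss') => ->; move/seq.permP: (tt') => -> e.
rewrite (perm_trans ss') // perm_sym (perm_trans tt') //.
by move: s'_in t'_in e; rewrite !inE => /or3P[] /eqP-> /or3P[] /eqP->.
Qed.

Section FactorType.
Variable F : finFieldType.
Implicit Types (p f : {poly F}) (lambda : seq nat).

Lemma total_mup_irreducible f : f \is monic -> irreducible_poly f ->
  total_mup f = (size f == 2)%N.
Proof.
move=> f_mon [f_gt1 f_irr]; have [f2|f_neq2] := eqVneq (size f) 2%N.
  by rewrite (monic_size2 f_mon f2) total_mup_XsubC.
apply: total_mup_noroot => u; apply: contra f_neq2; rewrite root_factor_theorem.
move=> /f_irr; rewrite size_XsubC => /(_ isT)/eqp_size.
by rewrite size_XsubC => <-.
Qed.

Lemma total_mupX p k : p != 0 -> total_mup (p ^+ k) = (k * total_mup p)%N.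
Proof.
move=> p0; elim: k => [|k IHk].
  by rewrite total_mup_noroot // => u; rewrite root1.
by rewrite exprS total_mupM ?expf_neq0 // IHk.
Qed.

(** The parts 1 of the type come from the linear factors, which carry all the
    roots; so this number does not depend on the factorization. *)
Lemma factor_type_degrees p lambda : factor_type p lambda ->
  [/\ all (leq 1) lambda, sumn lambda = (size p).-1 &
      count_mem 1%N lambda = total_mup p].
Proof.
case=> fs [_ fs_irr -> lam].
rewrite (perm_all _ lam) (perm_sumn lam).
move/seq.permP: lam => ->; elim: fs fs_irr => [|[f k] fs IHfs] fs_irr.
  by rewrite big_nil size_poly1 total_mup_noroot // => u; rewrite root1.
have [/= f_mon f_irr k_gt0] := fs_irr _ (mem_head _ _).
have [|IH1 IH2 IH3] := IHfs.
  by move=> fa fa_in; apply: fs_irr; rewrite inE fa_in orbT.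
have prod_mon : \prod_(fa <- fs) fa.1 ^+ fa.2 \is monic.
  rewrite big_seq; apply: monic_prod => fa fa_in; apply: monic_exp.
  by have [] := fs_irr fa; rewrite // inE fa_in orbT.
have f_gt1 : (1 < size f)%N by case: f_irr.
rewrite /= all_cat sumn_cat count_cat IH1 IH2 IH3 big_cons /=.
rewrite all_nseq sumn_nseq count_nseq.
split.
- by rewrite andbT; case: (size f) f_gt1 => [|[|m]] //= _; rewrite orbT.
- rewrite size_Mmonic ?monic_neq0 ?monic_exp //.
  have -> : size (f ^+ k) = ((size f).-1 * k).+1.
    by rewrite -size_exp prednK // size_poly_gt0 monic_neq0 ?monic_exp.
  by have := monic_neq0 prod_mon; rewrite -size_poly_gt0 mulnC addSn;
     case: (size _) => // s _; rewrite addnS.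
- rewrite total_mupM ?monic_neq0 ?monic_exp // total_mupX ?monic_neq0 //.
  by rewrite (total_mup_irreducible f_mon f_irr) mulnC; case: (size f) f_gt1.
Qed.

Lemma factor_type_exists p :
  p \is monic -> exists lambda, factor_type p lambda.
Proof.
move=> p_mon; suff [gs gs_irr ->] : exists2 gs : seq {poly F},
    forall g, g \in gs -> g \is monic /\ irreducible_poly g &
    p = \prod_(g <- gs) g.
  exists [seq (size (g : {poly F})).-1 | g <- gs].
  exists [seq (g, count_mem g gs) | g <- undup gs]; split.
  - by rewrite -map_comp map_id undup_uniq.
  - move=> fa /mapP[g]; rewrite mem_undup => g_in -> /=.
    by have [g_mon g_irr] := gs_irr g g_in; split; rewrite // -has_count has_pred1.
  - by rewrite big_map /= prodr_undup_exp_count.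
  - rewrite -map_comp /comp /=.
    have -> : [seq nseq (count_mem g gs) (size (g : {poly F})).-1 | g <- undup gs] =
      map (map (fun g : {poly F} => (size g).-1))
        [seq nseq (count_mem g gs) g | g <- undup gs].
      by rewrite -map_comp; apply: eq_map => g /=; rewrite map_nseq.
    rewrite -map_flatten; apply: perm_map.
    by rewrite perm_sym perm_count_undup.
have [n] := ubnP (size p); elim: n => // n IHn in p p_mon *; rewrite ltnS => le_p_n.
have [p_irr|] := EM (irreducible_poly p).
  by exists [:: p]; [move=> g; rewrite inE => /eqP->|rewrite big_seq1].
have [p1|p_neq1] := eqVneq (size p) 1%N.
  move=> _; exists [::] => //; rewrite big_nil; apply/eqP.
  by rewrite -eqp_monic ?monic1 // -size_poly_eq1 p1.
move=> p_red.
have [q [q_mon q1 qp q_neq]] : exists q,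
    [/\ q \is monic, size q != 1%N, q %| p & size q != size p].
  apply: contrapT => no_q; apply: p_red; split.
    have := size_poly_gt0 p; rewrite monic_neq0 //.
    by case: (size p) p_neq1 => [|[]].
  move=> q q1 qp; rewrite -dvdp_size_eqp //; apply: contrapT => /negP q_neq.
  have q0 : q != 0.
    by apply: contraTneq qp => ->; rewrite dvd0p monic_neq0.
  have lq : lead_coef q != 0 by rewrite lead_coef_eq0.
  apply: no_q; exists ((lead_coef q)^-1 *: q).
  rewrite size_scale ?invr_eq0 // dvdpZl ?invr_eq0 //; split=> //.
  by rewrite monicE lead_coefZ mulVf.
have [r def_p] := dvdpP _ _ qp; have r_mon : r \is monic.
  by move: p_mon; rewrite def_p (monicMr _ q_mon).
have sz_p : (size p = (size r + size q).-1)%N.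
  by rewrite def_p size_Mmonic ?monic_neq0.
have q_gt1 : (1 < size q)%N.
  have := monic_neq0 q_mon; rewrite -size_poly_gt0.
  by case: (size q) q1 => [|[]].
have r_gt0 : (0 < size r)%N by rewrite size_poly_gt0 monic_neq0.
have lt_q : (size q < n)%N.
  by apply: leq_trans le_p_n; rewrite ltn_neqAle q_neq dvdp_leq ?monic_neq0.
have lt_r : (size r < n)%N by apply: leq_trans le_p_n; rewrite sz_p; lia.
have [gs gs_irr def_q] := IHn q q_mon lt_q.
have [hs hs_irr def_r] := IHn r r_mon lt_r.
exists (hs ++ gs); last by rewrite big_cat -def_r -def_q.
by move=> g; rewrite mem_cat => /orP[/hs_irr|/gs_irr].
Qed.

(** Existence of a factorization turns the invariance of the number of roots
    into a criterion, since a partition of 3 is determined by its parts 1. *)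
Lemma factor_type_perm3P p (w : 'S_3) : p \is monic -> size p = 4%N ->
  factor_type p (cycle_type w) <-> #|fixpts w| = total_mup p.
Proof.
move=> p_mon p4; rewrite -count1_cycle_type; split=> [/factor_type_degrees[] //|].
have [lam [fs [fs_uniq fs_irr def_p lam_fs]]] := factor_type_exists p_mon.
have [|lam0 lam_sum lam_count] := @factor_type_degrees p lam; first by exists fs.
rewrite -lam_count => e; exists fs; split=> //.
rewrite (perm_trans _ lam_fs) // partition3_perm_eq ?cycle_type_gt0 //.
  by rewrite sumn_cycle_type card_ord.
by rewrite lam_sum p4.
Qed.

End FactorType.

(** * The symmetric group S_3 *)

Section S3.
Implicit Types (w g : 'S_3).

Let i0 : 'I_3 := ord0.
Let i1 : 'I_3 := @Ordinal 3 1 isT.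
Let i2 : 'I_3 := ord_max.
Let t01 : 'S_3 := tperm i0 i1.
Let t12 : 'S_3 := tperm i1 i2.
Let t02 : 'S_3 := tperm i0 i2.

Let S3_seq : seq 'S_3 := [:: 1; t01; t12; t02; t01 * t12; t12 * t01]%g.

(** Permutations of three points are told apart and computed with through
    their values. *)
Let values w : 'I_3 * 'I_3 * 'I_3 := (w i0, w i1, w i2).

Let values_S3 : [seq values w | w <- S3_seq] =
  [:: (i0, i1, i2); (i1, i0, i2); (i0, i2, i1); (i2, i1, i0);
      (i2, i0, i1); (i1, i2, i0)].
Proof.
rewrite /= /values !permM !perm1 !(tpermL, tpermR).
have -> : t01 i2 = i2 by rewrite tpermD.
have -> : t12 i0 = i0 by rewrite tpermD.
have -> : t02 i1 = i1 by rewrite tpermD.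
by rewrite !(tpermL, tpermR).
Qed.

Let S3_enum : perm_eq (index_enum 'S_3) S3_seq.
Proof.
have S3_uniq : uniq S3_seq by apply: (@map_uniq _ _ values); rewrite values_S3.
apply: uniq_perm; rewrite ?index_enum_uniq // => w; rewrite mem_index_enum.
have eqS : S3_seq =i 'S_3.
  apply/subset_cardP; last exact/fintype.subsetP.
  by rewrite (card_uniqP S3_uniq) card_Sn.
by rewrite eqS.
Qed.

Let card_fixpts w : #|fixpts w| = ((w i0 == i0) + (w i1 == i1) + (w i2 == i2))%N.
Proof.
rewrite /fixpts -sum1dep_card big_mkcond !big_ord_recl big_ord0 /= addn0 addnA.
have -> : lift ord0 (ord0 : 'I_2) = i1 by apply: val_inj.
have -> : lift ord0 (lift ord0 (ord0 : 'I_1)) = i2 by apply: val_inj.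
by do 3! case: (_ == _).
Qed.

Let nfix (x : 'I_3 * 'I_3 * 'I_3) : nat :=
  (x.1.1 == i0) + (x.1.2 == i1) + (x.2 == i2).

Let map_fixpts :
  [seq #|fixpts w| | w <- S3_seq] = [:: 3; 1; 1; 1; 0; 0]%N.
Proof.
rewrite (eq_map (g := nfix \o values)) => [|w]; last exact: card_fixpts.
by rewrite map_comp values_S3.
Qed.

Lemma card_fixpts_S3 w : #|fixpts w| \in [:: 3; 1; 0]%N.
Proof.
have : #|fixpts w| \in [seq #|fixpts w| | w <- S3_seq].
  by apply: map_f; rewrite -(perm_mem S3_enum) mem_index_enum.
by rewrite map_fixpts !inE; do 3! case: (_ == _).
Qed.

Lemma card_fixptsJ w g : #|fixpts (w ^ g)%g| = #|fixpts w|.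
Proof.
rewrite -[RHS](card_imset _ (@perm_inj _ g)); apply: eq_card => x.
rewrite [LHS]inE; apply/eqP/imsetP => [wgx|[y]].
  exists (g^-1 x)%g; last by rewrite permKV.
  rewrite inE; apply/eqP/(@perm_inj _ g); rewrite permKV -{2}wgx.
  by rewrite conjgE !permM.
by rewrite inE => /eqP wy ->; rewrite permJ wy.
Qed.

(** The three transpositions are conjugate, and so are the two 3-cycles. *)
Lemma class_S3_fixpts w :
  (w ^: [set: 'S_3])%g = [set v | #|fixpts v| == #|fixpts w|].
Proof.
pose rep k : 'S_3 := nth (t01 * t12)%g [:: (t01 * t12)%g; t01; 1%g; 1%g] k.
have in_rep v : (v \in rep #|fixpts v| ^: [set: 'S_3])%g.
  have /(nthP 1%g)[k lt_k <-] : v \in S3_seq.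
    by rewrite -(perm_mem S3_enum) mem_index_enum.
  have := congr1 (fun s => nth 0%N s k) map_fixpts.
  rewrite (nth_map 1%g) // => ->.
  case: k lt_k => [|[|[|[|[|[|//]]]]]] _ /=; rewrite /rep /=.
  - exact: class_refl.
  - exact: class_refl.
  - have -> : t12 = (t01 ^ t02)%g.
      rewrite tpermJ tpermL (_ : t02 i1 = i1); first exact: tpermC.
      by rewrite tpermD.
    by apply: memJ_class; rewrite inE.
  - have -> : t02 = (t01 ^ t12)%g.
      by rewrite tpermJ tpermL (_ : t12 i0 = i0) // tpermD.
    by apply: memJ_class; rewrite inE.
  - exact: class_refl.
  - have -> : (t12 * t01 = (t01 * t12) ^ t01)%g.
      by rewrite conjgE -mulgA mulKg.
    by apply: memJ_class; rewrite inE.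
apply/setP => v; rewrite inE; apply/idP/eqP => [/imsetP[g _ ->]|e].
  exact: card_fixptsJ.
have := in_rep v; rewrite e => v_rep.
by rewrite (class_eqP (in_rep w)).
Qed.

(** The sums are grouped by k = 3, 1, 0, that is, by the identity, the
    transpositions and the 3-cycles. *)
Lemma sum_cellini_fixpts q k :
  (\sum_(w : 'S_3 | #|fixpts w| == k) #|` fset_set (cellini_vectors q w)|)%N =
  (match k with
  | 3 => cellini_count q false false true
  | 1 => cellini_count q true false true + cellini_count q false true true +
         cellini_count q true true false
  | 0 => cellini_count q true false false + cellini_count q false true false
  | _ => 0
  end)%N.
Proof.
pose f (x : 'I_3 * 'I_3 * 'I_3) :=
  cellini_count q (x.1.2 < x.1.1)%N (x.2 < x.1.2)%N (x.1.1 < x.2)%N.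
have fE w : #|` fset_set (cellini_vectors q w)| = f (values w).
  exact: card_cellini_vectors.
rewrite (perm_big _ S3_enum) /=.
rewrite (eq_bigl (fun w => nfix (values w) == k)) => [|w]; last first.
  by rewrite card_fixpts.
rewrite (eq_bigr (fun w => f (values w))) //.
rewrite -(big_map values (fun x => nfix x == k) f).
rewrite values_S3 !big_cons big_nil /nfix /f /=.
by case: k => [|[|[|[|k]]]] //=; rewrite !addn0 ?addnA.
Qed.

End S3.

(** * Roots in an extension of a finite field *)

Section FiniteFieldClosure.
Variables (F : finFieldType) (K : fieldType) (iota : {rmorphism F -> K}).
Implicit Types (x y : K) (p : {poly F}).

Lemma expfqD x y : (x + y) ^+ #|F| = x ^+ #|F| + y ^+ #|F|.
Proof.
apply: exprDn_pchar; have [p p_pr pcharFp] := finPcharP F.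
rewrite (card_pprimeChar pcharFp) pnatX; apply/orP; left.
by rewrite pnatE // (fmorph_pchar iota).
Qed.

Lemma horner_map_expfq p x :
  (map_poly iota p).[x ^+ #|F|] = (map_poly iota p).[x] ^+ #|F|.
Proof.
elim/poly_ind: p => [|p a IHp].
  by rewrite rmorph0 !horner0 expr0n; case: #|F| (finNzRing_gt1 F).
rewrite rmorphD rmorphM /= map_polyX map_polyC !hornerE IHp.
by rewrite expfqD exprMn -rmorphXn expf_card.
Qed.

Lemma fixed_expfqP x : x ^+ #|F| = x -> exists a, x = iota a.
Proof.
move=> xq; have : root (map_poly iota ('X^#|F| - 'X)) x.
  by rewrite rmorphB /= map_polyXn map_polyX rootE !hornerE xq subrr.
rewrite finField_genPoly rmorph_prod -big_enum /=.
under eq_bigr do rewrite rmorphB /= map_polyX map_polyC /=.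
rewrite -(big_map iota xpredT (fun y => 'X - y%:P)) root_prod_XsubC.
by case/mapP=> a _ ->; exists a.
Qed.

(** The Frobenius map sends a repeated root to a repeated root, that is, to a
    common root with the derivative. A cubic has at most one of these; so it is
    fixed, hence in F, and then all three roots are in F. *)
Lemma nonsplit_cubic_separable (c : F * F) (rs : seq K) : ~~ split_cubic c ->
  map_poly iota (cubic c) = \prod_(x <- rs) ('X - x%:P) -> uniq rs.
Proof.
move=> nsplit def_c.
have sz : size rs = 3%N.
  apply: succn_inj; rewrite -(size_prod_XsubC rs id) -def_c size_map_poly.
  exact: size_cubic.
suff no2 x z :
    map_poly iota (cubic c) = \prod_(y <- [:: x; x; z]) ('X - y%:P) -> False.
  case: rs sz def_c => [|x [|y [|z [|//]]]] // _ def_c.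
  rewrite /= !inE andbT negb_or.
  have prodE s : perm_eq [:: x; y; z] s ->
      map_poly iota (cubic c) = \prod_(t <- s) ('X - t%:P).
    by move=> /(perm_big _) <-.
  rewrite -andbA; apply/and3P; split; apply/eqP => e; subst.
  - exact: (no2 y z).
  - by apply: (no2 z y); apply: prodE; apply/seq.permP => P /=; lia.
  - by apply: (no2 z x); apply: prodE; apply/seq.permP => P /=; lia.
move=> {rs sz} {}def_c; set p := cubic c in def_c.
have dp y : (map_poly iota p^`()).[y] = (y - x) * (y - z + (y - z) + (y - x)).
  rewrite -deriv_map def_c !big_cons big_nil mulr1 !(derivM, derivXsubC).
  by rewrite !(mul1r, mulr1) !(hornerXsubC, hornerD, hornerM); ring.
have root_x : root (map_poly iota p) x by rewrite def_c root_prod_XsubC mem_head.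
have droot_xq : (map_poly iota p^`()).[x ^+ #|F|] = 0.
  by rewrite horner_map_expfq dp subrr mul0r expr0n; case: #|F| (finNzRing_gt1 F).
have : root (map_poly iota p) (x ^+ #|F|).
  rewrite rootE horner_map_expfq (rootP root_x) expr0n.
  by case: #|F| (finNzRing_gt1 F).
(* a root in F that is also a root of the derivative is a root of the cofactor *)
have xFx_absurd : x ^+ #|F| <> x.
  move=> xFx; have [a def_x] := fixed_expfqP xFx.
  have pa : root p a by rewrite -(fmorph_root iota) -def_x.
  have [r [_ _ def_p /(_ a)/negP[]]] := nonsplit_cubic_factor nsplit pa.
  move: droot_xq; rewrite xFx def_x horner_map /p def_p derivM derivXsubC !hornerE.
  by rewrite subrr mul0r addr0 => /eqP; rewrite fmorph_eq0.
rewrite def_c root_prod_XsubC !inE orbA orbb => /orP[/eqP//|/eqP xFz].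
move: droot_xq; rewrite xFz dp subrr !add0r => /eqP.
rewrite mulf_eq0 orbb subr_eq0 => /eqP zx.
by apply: xFx_absurd; rewrite xFz.
Qed.

End FiniteFieldClosure.

(** * Similarity of matrices *)

Definition similar_mx (R : fieldType) n (A B : 'M[R]_n) : Prop :=
  exists2 P, P \in unitmx & P *m A = B *m P.

Section Similarity.
Variable R : fieldType.

Lemma similar_mx_sym n (A B : 'M[R]_n) : similar_mx A B -> similar_mx B A.
Proof.
case=> P uP PA; exists (invmx P); first by rewrite unitmx_inv.
by apply: (canRL (mulmxK uP)); rewrite -mulmxA -PA mulKmx.
Qed.

Lemma similar_mx_trans n (A B C : 'M[R]_n) :
  similar_mx A B -> similar_mx B C -> similar_mx A C.
Proof.
case=> P uP PA [Q uQ QB]; exists (Q *m P); first by rewrite unitmx_mul uQ.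
by rewrite -mulmxA PA mulmxA QB mulmxA.
Qed.

Lemma similar_char_poly n (A B : 'M[R]_n) :
  similar_mx A B -> char_poly A = char_poly B.
Proof.
case=> P uP PA; pose P' := map_mx polyC P.
have detP' : \det P' != 0 by rewrite det_map_mx polyC_eq0 -unitfE -unitmxE.
apply: (mulfI detP'); rewrite /char_poly -det_mulmx mulrC -det_mulmx.
congr (\det _); rewrite /char_poly_mx mulmxBr mulmxBl scalar_mxC.
by rewrite -!map_mxM PA.
Qed.

Lemma char_poly_diag n (d : 'rV[R]_n) :
  char_poly (diag_mx d) = \prod_(i < n) ('X - (d 0 i)%:P).
Proof.
rewrite char_poly_trig ?diag_mx_is_trig //.
by apply: eq_bigr => i _; rewrite mxE eqxx.
Qed.

Lemma diagonalizable_similar n (A : 'M[R]_n) : diagonalizable A ->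
  exists d, similar_mx A (diag_mx d).
Proof.
case=> P uP /similar_diagPex[d /(similarP uP) PA].
by exists d, P.
Qed.

Lemma perm_diag_similar n (d e : 'rV[R]_n) :
  perm_eq [seq d 0 i | i <- enum 'I_n] [seq e 0 i | i <- enum 'I_n] ->
  similar_mx (diag_mx e) (diag_mx d).
Proof.
have -> : [seq e 0 i | i <- enum 'I_n] = [tuple e 0 i | i < n] by [].
case/tuple_permP=> s def_d; exists (perm_mx s); first exact: unitmx_perm.
have ds i : d 0 i = e 0 (s i).
  have := congr1 (fun t => nth 0 t i) def_d.
  rewrite (nth_map i) ?size_enum_ord // nth_ord_enum => ->.
  by rewrite -tnth_nth !tnth_mktuple.
apply/matrixP => i j; rewrite mul_mx_diag mul_diag_mx !mxE ds.
by case: eqVneq => [<-|_]; rewrite ?mulr0 ?mul0r ?mulr1 ?mul1r.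
Qed.

Lemma diagonalizable_char_poly_similar n (A B : 'M[R]_n) :
  diagonalizable A -> diagonalizable B -> char_poly A = char_poly B ->
  similar_mx A B.
Proof.
move=> /diagonalizable_similar[d Ad] /diagonalizable_similar[e Be].
rewrite (similar_char_poly Ad) (similar_char_poly Be) !char_poly_diag => de.
apply: similar_mx_trans Ad (similar_mx_trans _ (similar_mx_sym Be)).
apply: perm_diag_similar; apply: prod_XsubC_eq.
by rewrite !big_image /= de.
Qed.

Definition cyclic_vector n (A : 'M[R]_n.+1) (v : 'rV_n.+1) : Prop :=
  forall g : {poly R}, (size g <= n.+1)%N -> v *m horner_mx A g = 0 -> g = 0.

(** In the basis v, v A, v A^2, ... the matrix becomes the companion matrix of
    its characteristic polynomial. *)
Lemma cyclic_similar_companion n (A : 'M[R]_n.+1) (v : 'rV_n.+1) :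
  cyclic_vector A v ->
  similar_mx A (\matrix_(i, j) if i == n :> nat then - (char_poly A)`_j
                               else (i.+1 == j)%:R).
Proof.
move=> v_cyc; pose M : 'M_n.+1 := \matrix_i (v *m A ^+ i).
have MA (u : 'rV_n.+1) : u *m M = v *m horner_mx A (rVpoly u).
  rewrite mulmx_sum_row /rVpoly poly_def rmorph_sum mulmx_sumr; apply: eq_bigr => i _.
  rewrite rowK /= horner_mxZ rmorphXn /= horner_mx_X scalemxAr.
  by case: insubP => [k _ /ord_inj->|]; rewrite ?ltn_ord.
exists M.
  rewrite -row_free_unit; apply/inj_row_free => u; rewrite MA => /v_cyc u0.
  have : rVpoly u = 0 by apply: u0; rewrite size_poly.
  by move/(congr1 (@poly_rV _ n.+1)); rewrite rVpolyK linear0.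
apply/row_matrixP => i; rewrite !row_mul rowK -mulmxA.
have -> : A ^+ i *m A = A ^+ i.+1 by rewrite exprSr.
have [i_n|i_n] := eqVneq (i : nat) n; last first.
  have lt_i : (i.+1 < n.+1)%N by rewrite ltnS ltn_neqAle i_n -ltnS ltn_ord.
  transitivity (row (Ordinal lt_i) M); first by rewrite rowK.
  rewrite rowE; congr (_ *m _); apply/rowP => j; rewrite !mxE (negPf i_n).
  by rewrite -val_eqE /= eq_sym.
have vAn : v *m A ^+ n.+1 = \sum_(k < n.+1) - (char_poly A)`_k *: (v *m A ^+ k).
  have cp_size := size_char_poly A.
  have : v *m horner_mx A (char_poly A) = 0 by rewrite Cayley_Hamilton mulmx0.
  rewrite -{1}[char_poly A]coefK cp_size poly_def rmorph_sum mulmx_sumr big_ord_recr /=.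
  have -> : (char_poly A)`_n.+1 = 1.
    by move/monicP: (char_poly_monic A); rewrite lead_coefE cp_size.
  rewrite scale1r rmorphXn /= horner_mx_X => /eqP; rewrite addrC addr_eq0 => /eqP->.
  rewrite -sumrN; apply: eq_bigr => k _.
  by rewrite horner_mxZ rmorphXn /= horner_mx_X scaleNr scalemxAr.
rewrite i_n vAn mulmx_sum_row; apply: eq_bigr => j _.
by rewrite rowK !mxE i_n eqxx.
Qed.

Lemma cyclic_similar n (A B : 'M[R]_n.+1) v w :
  cyclic_vector A v -> cyclic_vector B w -> char_poly A = char_poly B ->
  similar_mx A B.
Proof.
move=> /cyclic_similar_companion simA /cyclic_similar_companion simB cAB.
by apply: similar_mx_trans simA (similar_mx_sym _); rewrite cAB.
Qed.

End Similarity.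

Lemma eigenvector_horner (R : fieldType) n (A : 'M[R]_n.+1) (v : 'rV_n.+1) u g :
  v *m A = u *: v -> v *m horner_mx A g = g.[u] *: v.
Proof.
move=> vA; elim/poly_ind: g => [|g a IHg].
  by rewrite rmorph0 mulmx0 horner0 scale0r.
rewrite rmorphD rmorphM /= horner_mx_X horner_mx_C mulmxDr hornerMXaddC scalerDl.
by rewrite mulmxA IHg -scalemxAl vA scalerA mul_mx_scalar.
Qed.

(** The polynomials h such that h(A) kills v form an ideal, which contains the
    characteristic polynomial. *)
Lemma gcdp_horner_mx0 (R : fieldType) n (A : 'M[R]_n.+1) (v : 'rV_n.+1) g :
  v *m horner_mx A g = 0 -> v *m horner_mx A (gcdp g (char_poly A)) = 0.
Proof.
move=> vg; have [[a b] /= /eqpP[[k l] /= /andP[k0 l0] e]] := Bezoutp g (char_poly A).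
have {e} : l *: gcdp g (char_poly A) = g * (k *: a) + char_poly A * (k *: b).
  by rewrite -e scalerDr -!scalerAr [a * _]mulrC [b * _]mulrC.
move/(congr1 (fun h => v *m horner_mx A h)).
rewrite rmorphD !rmorphM /= Cayley_Hamilton mul0r addr0 mulmxA vg mul0mx.
rewrite horner_mxZ -scalemxAr => /eqP; rewrite scaler_eq0 (negPf l0).
by move/eqP.
Qed.

Lemma dvdp_horner_mx0 (R : fieldType) n (A : 'M[R]_n.+1) (v : 'rV_n.+1) d g :
  d %| g -> v *m horner_mx A d = 0 -> v *m horner_mx A g = 0.
Proof.
by case/dvdpP=> h -> vd; rewrite mulrC rmorphM /= mulmxA vd mul0mx.
Qed.

Section CubicSimilarity.
Variable F : finFieldType.
Implicit Types (A B : 'M[F]_3) (c : F * F) (v : 'rV[F]_3).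

(** A nonsplit cubic has at most one linear factor, which leaves few divisors. *)
Lemma nonsplit_cubic_dvdp c d : ~~ split_cubic c -> d %| cubic c ->
  (size d <= 3)%N -> size d != 1%N ->
  exists u r, [/\ cubic c = ('X - u%:P) * r, forall x, ~~ root r x &
                  d %| 'X - u%:P \/ d %| r].
Proof.
move=> nsplit dc d_le3 d_neq1; have [e def_c] := dvdpP _ _ dc.
have ed0 : e * d != 0 by rewrite -def_c cubic_neq0.
have [e0 d0] : e != 0 /\ d != 0 by apply/andP; rewrite -negb_or -mulf_eq0.
have sz : (size e + size d = 5)%N.
  by have := size_cubic c; rewrite def_c size_mul //; case: (_ + _)%N => //= k ->.
have rootE (h : {poly F}) u : size h = 2%N -> root h u -> h %= 'X - u%:P.
  move=> sh; rewrite root_factor_theorem eqp_sym => hu.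
  by rewrite -dvdp_size_eqp // sh size_XsubC.
have [d2|d_neq2] := eqVneq (size d) 2%N.
  have [u du] := poly2_root d2.
  have cu : root (cubic c) u by rewrite def_c rootM du orbT.
  have [r [_ _ def_r no_r]] := nonsplit_cubic_factor nsplit cu.
  by exists u, r; split=> //; left; have /andP[] := rootE d u d2 du.
have e2 : size e = 2%N by move: d0 d_neq1 d_neq2; rewrite -size_poly_eq0; lia.
have [u eu] := poly2_root e2.
have cu : root (cubic c) u by rewrite def_c rootM eu.
have [r [_ _ def_r no_r]] := nonsplit_cubic_factor nsplit cu.
exists u, r; split=> //; right.
rewrite -(dvdp_mul2l _ _ (monic_neq0 (monicXsubC u))) -def_r def_c.
by apply: dvdp_mul; rewrite ?dvdpp //; have /andP[] := rootE e u e2 eu.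
Qed.

(** If v is killed by g(A) with g of degree at most 2, then it is killed by
    d(A) for a proper divisor d of the characteristic polynomial. Without roots
    no v <> 0 is killed. For the polynomial (X - u) r, the sum of an eigenvector
    of u and of a nonzero vector of the kernel of r(A) is killed neither by
    A - u nor by r(A). *)
Lemma nonsplit_cyclic_vector c A : ~~ split_cubic c -> char_poly A = cubic c ->
  exists v, cyclic_vector A v.
Proof.
move=> nsplit cA.
suff [v v0 v_ker] : exists2 v : 'rV_3, v != 0 & forall u r,
    cubic c = ('X - u%:P) * r -> (forall x, ~~ root r x) ->
    v *m horner_mx A ('X - u%:P) != 0 /\ v *m horner_mx A r != 0.
  exists v => g sg vg; apply/eqP/negPn/negP => g0.
  have := gcdp_horner_mx0 vg; rewrite cA => vd.
  set d := gcdp g (cubic c) in vd.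
  have d_le3 : (size d <= 3)%N by apply: leq_trans sg; rewrite dvdp_leq ?dvdp_gcdl.
  have [/eqP|d_neq1] := eqVneq (size d) 1%N.
    case/size_poly1P=> k k0 def_d; case/eqP: v0.
    move: vd; rewrite def_d horner_mx_C mul_mx_scalar => /eqP.
    by rewrite scaler_eq0 (negPf k0) => /eqP.
  have [u [r [def_c no_r d_dvd]]] :=
    nonsplit_cubic_dvdp nsplit (dvdp_gcdr _ _) d_le3 d_neq1.
  have [/eqP vu /eqP vr] := v_ker u r def_c no_r.
  by case: d_dvd => /dvdp_horner_mx0/(_ vd).
have [[u cu]|no_root] := EM (exists u, root (cubic c) u); last first.
  exists (delta_mx 0 0) => [|u r def_c].
    by apply/eqP => /rowP/(_ 0)/eqP; rewrite !mxE eqxx oner_eq0.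
  by case: no_root; exists u; rewrite def_c rootM root_XsubC eqxx.
have [r [r_mon sr def_c no_r]] := nonsplit_cubic_factor nsplit cu.
have /eigenvalueP[e eA e0] : eigenvalue A u by rewrite eigenvalue_root_char cA.
have hXu : horner_mx A ('X - u%:P) = A - u%:M.
  by rewrite rmorphB /= horner_mx_X horner_mx_C.
(* the rows of A - u are in the kernel of r(A), by Cayley-Hamilton *)
have [i f0] : exists i, row i (A - u%:M) != 0.
  apply/existsP; apply: contraT => /existsPn A_u.
  have def_A : A = u%:M.
    apply/eqP; rewrite -subr_eq0; apply/eqP/row_matrixP => i.
    by rewrite row0; apply/eqP; have := A_u i; rewrite negbK.
  case/negP: nsplit; apply/split_cubicP; exists u, u, u.
  rewrite -cA def_A char_poly_trig ?scalar_mx_is_trig //.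
  by rewrite !big_ord_recl !big_cons big_ord0 big_nil !mxE !eqxx.
set f := row i _ in f0; have fr : f *m horner_mx A r = 0.
  rewrite -row_mul -hXu.
  have -> : horner_mx A ('X - u%:P) *m horner_mx A r = 0.
    by rewrite -[LHS]rmorphM /= -def_c -cA Cayley_Hamilton.
  by rewrite row0.
have e_Xu : e *m horner_mx A ('X - u%:P) = 0.
  by rewrite (eigenvector_horner _ eA) hornerXsubC subrr scale0r.
have e_r : e *m horner_mx A r != 0.
  by rewrite (eigenvector_horner _ eA) scaler_eq0 negb_or e0 andbT; apply: no_r.
have f_Xu : f *m horner_mx A ('X - u%:P) != 0.
  apply/eqP; rewrite hXu mulmxBr mul_mx_scalar => /eqP; rewrite subr_eq0 => /eqP fA.
  move: fr; rewrite (eigenvector_horner _ fA) => /eqP.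
  by rewrite scaler_eq0 (negPf f0) orbF; apply/negP/no_r.
exists (e + f).
  by apply: contraNneq e_r => ef0; rewrite -[e](addrK f) ef0 sub0r mulNmx fr oppr0.
move=> u' r' def_c' no_r'; have eq_u : u' = u.
  have : root (cubic c) u' by rewrite def_c' rootM root_XsubC eqxx.
  by rewrite def_c rootM (negPf (no_r _)) orbF root_XsubC => /eqP.
have eq_r : r' = r.
  apply: (mulfI (monic_neq0 (monicXsubC u))).
  by rewrite -def_c -{1}eq_u def_c'.
by rewrite eq_u eq_r !mulmxDl e_Xu fr add0r addr0.
Qed.

End CubicSimilarity.

(** * Semisimple matrices with given characteristic polynomial *)

Lemma dvdp_prod_XsubC_monic (R : fieldType) (rs : seq R) (p : {poly R}) :
  p \is monic -> p %| \prod_(x <- rs) ('X - x%:P) ->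
  exists m, p = \prod_(x <- mask m rs) ('X - x%:P).
Proof.
move=> p_mon /dvdp_prod_XsubC[m pm]; exists m; apply/eqP.
by rewrite -eqp_monic // monic_prod // => x _; apply: monicXsubC.
Qed.

(** The dimension of a companion matrix is computed from its sequence of
    coefficients, which is 3 by conversion only for an explicit sequence. *)
Lemma char_poly_companion_seq (R : comNzRingType) (s : seq R) (p : {poly R}) :
  polyseq p = s -> p \is monic -> char_poly (companionmx s) = p.
Proof. by move=> <-; apply: companionmxK. Qed.

Lemma det_horner_mx (R : fieldType) n (A : 'M[R]_n.+1) (rs : seq R) g :
  diagonalizable A -> char_poly A = \prod_(x <- rs) ('X - x%:P) ->
  \det (horner_mx A g) = \prod_(x <- rs) g.[x].
Proof.
move=> /diagonalizable_similar[d simA].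
rewrite (similar_char_poly simA) char_poly_diag => dE.
case: simA => P uP PA.
have -> : A = invmx P *m diag_mx d *m P by rewrite -mulmxA -PA mulKmx.
rewrite horner_mx_uconjC // horner_mx_diag !det_mulmx det_inv mulrAC mulVf; last first.
  by rewrite -unitfE -unitmxE.
rewrite mul1r det_diag.
have : perm_eq [seq d 0 i | i <- enum 'I_n.+1] rs.
  by apply: prod_XsubC_eq; rewrite big_image /= dE.
move/(perm_big _)=> <- /=; rewrite big_image /=.
by apply: eq_bigr => i _; rewrite !mxE.
Qed.

Lemma det_scalar_sub (R : comNzRingType) n (A : 'M[R]_n) a :
  \det (a%:M - A) = (char_poly A).[a].
Proof.
rewrite /char_poly -[RHS]/(horner_eval a _) -det_map_mx; congr (\det _).
apply/matrixP => i j; rewrite !mxE /= /horner_eval !hornerE hornerMn.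
by rewrite hornerX.
Qed.

Section Semisimple.
Variable F : finFieldType.
Implicit Types (c : F * F).
Let iota := to_alg_closure F.

(** Diagonalizability means that the minimal polynomial is a product of
    distinct linear factors. This polynomial does not change with the field,
    and here its roots are in F. *)
Lemma split_semisimple_diagonalizable n (A : 'M[F]_n.+1) (s : seq F) :
  semisimple_mx A -> char_poly A = \prod_(x <- s) ('X - x%:P) ->
  diagonalizable A.
Proof.
move=> /diagonalizableP[rs rs_uniq]; rewrite mxminpoly_map => min_rs cA.
have [m min_m] : exists m,
    mxminpoly A = \prod_(x <- mask m s) ('X - x%:P).
  apply: dvdp_prod_XsubC_monic (mxminpoly_monic A) _.
  by rewrite -cA mxminpoly_dvd_char.
apply/diagonalizableP; exists (mask m s); last by rewrite min_m.
have [|m'] := dvdp_prod_XsubC_monic _ min_rs.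
  by rewrite map_monic mxminpoly_monic.
rewrite min_m rmorph_prod /=.
under eq_bigr do rewrite rmorphB /= map_polyX map_polyC /=.
rewrite -(big_map iota xpredT (fun y => 'X - y%:P)) => /prod_XsubC_eq/perm_uniq.
by rewrite mask_uniq // => /map_uniq.
Qed.

(** A matrix with split characteristic polynomial is diagonalizable over F, and
    one with nonsplit characteristic polynomial has a cyclic vector. *)
Lemma semisimple_similar c (A B : 'M[F]_3) :
  semisimple_mx A -> semisimple_mx B ->
  char_poly A = cubic c -> char_poly B = cubic c -> similar_mx A B.
Proof.
move=> ssA ssB cA cB; have [|nsplit] := boolP (split_cubic c).
  case/split_cubicP=> u [v [w def_c]].
  apply: diagonalizable_char_poly_similar; last by rewrite cA.
  - by apply: split_semisimple_diagonalizable ssA _; rewrite cA def_c.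
  - by apply: split_semisimple_diagonalizable ssB _; rewrite cB def_c.
have [v cycA] := nonsplit_cyclic_vector nsplit cA.
have [w cycB] := nonsplit_cyclic_vector nsplit cB.
by apply: cyclic_similar cycA cycB _; rewrite cA.
Qed.

(** The companion matrix of a nonsplit cubic is semisimple because the roots of
    the cubic in the closure are distinct. *)
Lemma semisimple_cubic_exists c :
  exists A : 'M[F]_3, semisimple_mx A /\ char_poly A = cubic c.
Proof.
have [|nsplit] := boolP (split_cubic c).
  case/split_cubicP=> u [v [w def_c]].
  exists (diag_mx (\row_i [:: u; v; w]`_i)); split.
    by rewrite /semisimple_mx map_diag_mx; apply: diagonalizable_diag.
  rewrite char_poly_diag def_c !big_ord_recl !big_cons big_ord0 big_nil.
  by rewrite !mxE.
exists (companionmx [:: -1; c.2; - c.1; 1]).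
have cA := char_poly_companion_seq (cubic_seq c) (cubic_monic c).
split=> //; apply/diagonalizableP.
have [rs] := closed_field_poly_normal (map_poly iota (cubic c)).
have /monicP-> : map_poly iota (cubic c) \is monic by rewrite map_monic cubic_monic.
rewrite scale1r => def_c; exists rs; first exact: nonsplit_cubic_separable def_c.
by rewrite -def_c mxminpoly_map dvdp_map -cA mxminpoly_dvd_char.
Qed.

(** The matrices 1 + s r(A) commute with A. Their eigenvalues are 1 + s r(u)
    for the simple root u of (X - u) r, and 1 for the roots of r. *)
Lemma centralizer_det_root (A : 'M[F]_3) c u r t :
  semisimple_mx A -> char_poly A = cubic c -> cubic c = ('X - u%:P) * r ->
  ~~ root r u -> exists2 Z, Z *m A = A *m Z & \det Z = t.
Proof.
move=> ssA cA def_c ru; pose s := (t - 1) / r.[u]; pose g := 1 + s%:P * r.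
exists (horner_mx A g); first exact: comm_horner_mx.
apply: (fmorph_inj iota); rewrite -det_map_mx map_horner_mx.
have r_mon : r \is monic.
  by rewrite -(monicMl _ (monicXsubC u)) -def_c cubic_monic.
have [rs] := closed_field_poly_normal (map_poly iota r).
have /monicP-> : map_poly iota r \is monic by rewrite map_monic.
rewrite scale1r => def_r.
rewrite (@det_horner_mx _ _ _ (iota u :: rs)) //; last first.
  rewrite -map_char_poly cA def_c rmorphM rmorphB /= map_polyX map_polyC /= def_r.
  by rewrite big_cons.
rewrite big_cons [X in _ * X]big1_seq ?mulr1 => [|x /= x_rs].
  rewrite horner_map /g hornerD hornerC hornerM hornerC; congr (iota _).
  by rewrite divfK ?subrKC //.
have rx : (map_poly iota r).[x] = 0.
  by apply/rootP; rewrite def_r root_prod_XsubC.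
rewrite /g rmorphD rmorph1 rmorphM /= map_polyC hornerD hornerM rx mulr0 addr0.
by rewrite -polyC1 hornerC.
Qed.

(** The determinants of the invertible matrices that commute with A form a
    subgroup H of the multiplicative group of F, which is cyclic. Let p be the
    characteristic polynomial. H contains all p(x) = det (x - A), so that
    p^|H| - 1, of degree 3 |H|, vanishes on F and the index of H is at most 2.
    H also contains the determinants of the scalar matrices, which are the
    cubes, so that its index divides 3. *)
Lemma centralizer_det_noroot (A : 'M[F]_3) t :
  (forall x, ~~ root (char_poly A) x) -> t != 0 ->
  exists2 Z, Z *m A = A *m Z & \det Z = t.
Proof.
move=> no_root t0; set p := char_poly A in no_root.
pose D (x : F) := exists2 Z, Z *m A = A *m Z & \det Z = x.
pose H := [set g : {unit F} | `[< D (val g) >]].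
have H_group : group_set H.
  apply/group_setP; split=> [|g h].
    by rewrite inE; apply/asboolP; exists 1%:M; rewrite ?mul1mx ?mulmx1 ?det1.
  rewrite !inE => /asboolP[Y YA dY] /asboolP[Z ZA dZ]; apply/asboolP.
  exists (Y *m Z); last by rewrite det_mulmx dY dZ.
  by rewrite -mulmxA ZA !mulmxA YA.
pose m := #|Group H_group|.
have m_gt0 : (0 < m)%N by apply: cardG_gt0.
have H_exp x : x != 0 -> D x -> x ^+ m = 1.
  rewrite -unitfE => Ux Dx; have : FinRing.Unit Ux \in Group H_group.
    by rewrite inE; apply/asboolP.
  by move/expg_cardG/(congr1 val); rewrite FinRing.val_unitX.
have [e def_q] : exists e, #|F|.-1 = (e * m)%N.
  by apply/dvdnP; rewrite -card_finField_unit cardSg ?finset.subsetT.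
have q_gt1 := finNzRing_gt1 F.
have p_mon : p \is monic := char_poly_monic A.
have sp : size p = 4%N := size_char_poly A.
have e_lt3 : (e < 3)%N.
  rewrite -(ltn_pmul2r m_gt0) -def_q prednK ?(ltnW q_gt1) //.
  have size_pm : size (p ^+ m) = (3 * m).+1.
    have <- : ((size p).-1 * m)%N = (3 * m)%N by rewrite sp.
    by rewrite -size_exp prednK // size_poly_gt0 monic_neq0 // monic_exp.
  have size_q : size (p ^+ m - 1) = (3 * m).+1.
    by rewrite size_polyDl size_pm // size_polyN size_poly1 ltnS muln_gt0.
  have q0 : p ^+ m - 1 != 0 by rewrite -size_poly_gt0 size_q.
  have : all (root (p ^+ m - 1)) (enum F).
    apply/allP => x _; rewrite rootE hornerD hornerN horner_exp.
    rewrite H_exp ?hornerE ?subrr // -?rootE //.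
    exists (x%:M - A); last exact: det_scalar_sub.
    by rewrite mulmxBl mulmxBr scalar_mxC.
  move/(max_poly_roots q0)/(_ (enum_uniq _)).
  by rewrite size_q -cardE ltnS.
have e_dvd3 : (e %| 3)%N.
  have /cyclicP[g def_g] := field_unit_group_cyclic [set: {unit F}]%G.
  rewrite -(dvdn_pmul2r m_gt0) -def_q -card_finField_unit.
  have -> : #|[set: {unit F}]| = #[g]%g by rewrite orderE -def_g.
  rewrite order_dvdn; apply/eqP/val_inj; rewrite FinRing.val_unitX exprM /=.
  apply: H_exp; first by rewrite expf_neq0 // -unitfE (valP g).
  exists (val g)%:M; first by rewrite scalar_mxC.
  by rewrite det_scalar.
have e1 : e = 1%N.
  by move: def_q e_lt3 e_dvd3; case: e => [|[|[|]]] //; lia.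
have HT : Group H_group :=: [set: {unit F}].
  apply/eqP; rewrite eqEcard finset.subsetT card_finField_unit def_q e1 mul1n /=.
  exact: leqnn.
rewrite -unitfE in t0; have : FinRing.Unit t0 \in Group H_group by rewrite HT inE.
by rewrite inE => /asboolP.
Qed.

End Semisimple.

(** * Semisimple classes of SL(3, F) *)

Lemma mem_class_intertwine (gT : finGroupType) (G : {group gT}) (x y g : gT) :
  g \in G -> (g * x = y * g)%g -> y \in (x ^: G)%g.
Proof.
move=> Gg gx; apply/imsetP; exists g^-1%g; rewrite ?groupV //.
by rewrite conjgE invgK mulgA gx mulgK.
Qed.

Section SLClasses.
Variable F : finFieldType.
Implicit Types (c : F * F).

(** Unless the characteristic polynomial has a triple root, it has a simple
    root in F or none at all. *)
Lemma semisimple_centralizer_det (A : 'M[F]_3) c t :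
  semisimple_mx A -> char_poly A = cubic c -> t != 0 ->
  (exists a, A = a%:M) \/ exists2 Z, Z *m A = A *m Z & \det Z = t.
Proof.
move=> ssA cA t0.
have [[u cu]|no_root] := EM (exists u, root (cubic c) u); last first.
  right; apply: centralizer_det_noroot => // x; rewrite cA; apply/negP => cx.
  by apply: no_root; exists x.
have [r [r_mon def_c]] := root_monic_factor (cubic_monic c) cu.
rewrite size_cubic => -[sr].
have [|ru] := boolP (root r u); last first.
  by right; apply: centralizer_det_root ssA cA def_c ru.
case/(root_monic_factor r_mon)=> s [s_mon def_r]; rewrite -sr => -[/esym ss].
have [w def_s] : exists w, s = 'X - w%:P by exists (- s`_0); apply: monic_size2.
have {r r_mon sr ss s_mon def_r def_s} def_c :
    cubic c = \prod_(x <- [:: u; u; w]) ('X - x%:P).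
  by rewrite !big_cons big_nil mulr1 -def_s -def_r.
have [euw|nuw] := eqVneq u w; last first.
  right; apply: (@centralizer_det_root _ A c w (('X - u%:P) ^+ 2)) => //.
    by rewrite def_c !big_cons big_nil mulr1; ring.
  by rewrite rootE !hornerE expf_neq0 // subr_eq0 eq_sym.
left; exists u; subst w.
have diagA : diagonalizable A.
  by apply: split_semisimple_diagonalizable ssA _; rewrite cA def_c.
have [d simA] := diagonalizable_similar diagA.
have d_u i : d 0 i = u.
  have : root (char_poly (diag_mx d)) (d 0 i).
    by rewrite char_poly_diag (bigD1 i) //= rootM root_XsubC eqxx.
  rewrite -(similar_char_poly simA) cA def_c root_prod_XsubC !inE !orbb.
  by move/eqP.
case: simA => P uP; have -> : diag_mx d = u%:M.
  by apply/matrixP => i j; rewrite !mxE d_u.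
rewrite mul_scalar_mx -mul_mx_scalar => /(congr1 (mulmx (invmx P))).
by rewrite !mulKmx.
Qed.

Lemma char_poly_det1 (A : 'M[F]_3) : \det A = 1 ->
  char_poly A = cubic (- (char_poly A)`_2, (char_poly A)`_1).
Proof.
move=> dA; apply: cubic_coef; rewrite ?char_poly_monic ?size_char_poly //.
by rewrite char_poly_det dA mulr1 -signr_odd.
Qed.

(** A matrix P of GL(3, F) that conjugates A to B is corrected to P Z of
    determinant 1 by a suitable Z that commutes with A. A scalar matrix is
    conjugate only to itself. *)
Lemma SL_semisimple_class (A B : {'GL_3[F]}) :
  A \in SL 3 F -> B \in SL 3 F ->
  semisimple_mx (GLval A) -> semisimple_mx (GLval B) ->
  char_poly (GLval A) = char_poly (GLval B) -> (B \in A ^: SL 3 F)%g.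
Proof.
rewrite !inE => /eqP dA /eqP dB ssA ssB cAB.
pose c := (- (char_poly (GLval A))`_2, (char_poly (GLval A))`_1).
have cA : char_poly (GLval A) = cubic c by apply: char_poly_det1.
have cB : char_poly (GLval B) = cubic c by rewrite -cAB.
have [P uP PA] := semisimple_similar ssA ssB cA cB.
have dP0 : \det P != 0 by rewrite -unitfE -unitmxE.
have dPV0 : (\det P)^-1 != 0 by rewrite invr_eq0.
have [[a def_A]|[Z ZA dZ]] := semisimple_centralizer_det ssA cA dPV0.
  have <- : A = B; last exact: class_refl.
  apply: val_inj; change (GLval A = GLval B); rewrite def_A in PA *.
  by apply: (can_inj (mulmxK uP)); rewrite -PA scalar_mxC.
have dPZ : \det (P *m Z) = 1 by rewrite det_mulmx dZ mulfV.
have uPZ : P *m Z \is a GRing.unit by rewrite unitmxE dPZ unitr1.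
pose g : {'GL_3[F]} := FinRing.Unit uPZ.
have gA : (g * A = B * g)%g.
  apply: val_inj; change ((P *m Z) *m GLval A = GLval B *m (P *m Z)).
  by rewrite -mulmxA ZA !mulmxA PA.
apply: (@mem_class_intertwine _ (SL_group 3 F) A B g _ gA).
by rewrite inE; apply/eqP.
Qed.

Definition class_coefs (X : {set {'GL_3[F]}}) : F * F :=
  (- (char_poly (GLval (repr X)))`_2, (char_poly (GLval (repr X)))`_1).

Lemma char_poly_classJ (A g : {'GL_3[F]}) :
  char_poly (GLval (A ^ g)%g) = char_poly (GLval A).
Proof.
apply: similar_char_poly; exists (GLval g).
  exact: (valP g).
have -> : GLval g *m GLval (A ^ g)%g = GLval (g * A ^ g)%g by [].
by rewrite conjgE mulKVg.
Qed.

Lemma char_poly_repr (A : {'GL_3[F]}) :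
  char_poly (GLval (repr (A ^: SL 3 F)%g)) = char_poly (GLval A).
Proof.
have : repr (A ^: SL 3 F)%g \in (A ^: SL 3 F)%g.
  by rewrite (mem_repr A) ?class_refl.
by case/imsetP=> g _ ->; apply: char_poly_classJ.
Qed.

Lemma semisimple_classP X : X \in semisimple_classes 3 F ->
  exists A : {'GL_3[F]}, [/\ A \in SL 3 F, semisimple_mx (GLval A),
    X = (A ^: SL 3 F)%g & char_poly (GLval A) = cubic (class_coefs X)].
Proof.
case/imsetP=> A; rewrite !inE => /andP[/eqP dA ssA] def_X; exists A.
have A_SL : A \in SL 3 F by rewrite inE dA.
split=> //; first by apply/asboolP.
by rewrite /class_coefs def_X char_poly_repr; apply: char_poly_det1.
Qed.

Lemma class_coefs_inj : {in semisimple_classes 3 F &, injective class_coefs}.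
Proof.
move=> X Y /semisimple_classP[A [A_SL ssA def_X cA]].
move=> /semisimple_classP[B [B_SL ssB def_Y cB]] eXY.
have BA : (B \in A ^: SL_group 3 F)%g.
  by apply: (SL_semisimple_class A_SL B_SL ssA ssB); rewrite cA eXY.
by rewrite def_X def_Y -(class_eqP BA).
Qed.

Lemma class_coefs_onto c : c \in class_coefs @: semisimple_classes 3 F.
Proof.
have [A [ssA cA]] := semisimple_cubic_exists c.
have dA : \det A = 1.
  have := char_poly_det A; rewrite cA cubic_seq /= -signr_odd /= expr1 mulN1r.
  by move/oppr_inj.
have uA : A \is a GRing.unit by rewrite unitmxE dA unitr1.
pose B : {'GL_3[F]} := FinRing.Unit uA.
have X_in : (B ^: SL 3 F)%g \in semisimple_classes 3 F.
  by apply/imsetP; exists B => //; rewrite !inE dA eqxx; apply/asboolP.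
apply/imsetP; exists (B ^: SL 3 F)%g => //.
have [B' [B'_SL _ def_X cB']] := semisimple_classP X_in.
apply: cubic_inj; rewrite -cB' -cA.
have : B \in (B' ^: SL 3 F)%g by rewrite -def_X class_refl.
case/imsetP=> g _ def_B; rewrite -(char_poly_classJ B' g) -def_B.
exact: erefl.
Qed.

Lemma card_classes_coefs (P : pred (F * F)) :
  #|[set X in semisimple_classes 3 F | P (class_coefs X)]| = #|[set c | P c]|.
Proof.
rewrite -(card_in_imset (f := class_coefs)); last first.
  move=> X Y; rewrite !inE => /andP[X_in _] /andP[Y_in _].
  exact: class_coefs_inj.
apply: eq_card => c; rewrite [RHS]inE; apply/imsetP/idP => [[X]|Pc].
  by rewrite inE => /andP[_ PX] ->.
have /imsetP[X X_in def_c] := class_coefs_onto c.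
by exists X; rewrite // inE X_in -def_c.
Qed.

Lemma card_semisimple_classes : #|semisimple_classes 3 F| = (#|F| ^ 2)%N.
Proof.
rewrite expnS expn1 -card_prod -cardsT -(card_classes_coefs xpredT).
by apply: eq_card => X; rewrite !inE andbT.
Qed.

Lemma Phi_cubic X : X \in semisimple_classes 3 F ->
  Phi X = [set w | #|fixpts w| == total_mup (cubic (class_coefs X))].
Proof.
move=> X_in; have cX : char_poly (GLval (repr X)) = cubic (class_coefs X).
  have [A [_ _ def_X <-]] := semisimple_classP X_in.
  by rewrite def_X char_poly_repr.
apply/setP => w; rewrite !inE cX.
have fw := factor_type_perm3P w (cubic_monic (class_coefs X)) (size_cubic _).
by apply/asboolP/eqP => /fw.
Qed.

End SLClasses.

(** * Comparison of the two counts *)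

(** On both sides the identity and the transpositions have explicit counts, and
    the three types together contribute q^2. *)
Lemma num_cubics_cellini (F : finFieldType) (w0 : 'S_3) :
  num_cubics F #|fixpts w0| =
  (\sum_(w : 'S_3 | #|fixpts w| == #|fixpts w0|)
     #|` fset_set (cellini_vectors #|F| w)|)%N.
Proof.
have q_gt0 : (0 < #|F|)%N by apply: ltnW (finNzRing_gt1 F).
have [N3 N1] := card_cubic_type F; have N0 := sum_num_cubics F.
have cT := cellini_count_transp #|F|; have cC := cellini_count_cycle #|F|.
have cI := cellini_count_id q_gt0; rewrite -card_cube_roots1 in cI.
rewrite (sum_cellini_fixpts #|F|).
have := card_fixpts_S3 w0; rewrite !inE => /or3P[] /eqP-> /=;
  move: #|F| #|cube_roots1 F| q_gt0 N0 N1 N3 cT cC cI => [|r] g // _ /=; lia.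
Qed.

Theorem theorem2 (q : nat) (F : finFieldType) (hF : #|F| = q) :
  #|semisimple_classes 3 F| = (q ^ 2)%N /\
  forall C : {set 'S_3}, C \in classes [set: 'S_3] ->
    unif_prob (semisimple_classes 3 F) (fun c => Phi c == C) =
    \sum_(w in C) cellini 2 q w.
Proof.
subst q; split=> [|C /imsetP[w0 _ def_C]]; first exact: card_semisimple_classes.
have {}def_C : C = [set w | #|fixpts w| == #|fixpts w0|].
  by rewrite def_C class_S3_fixpts.
have Phi_C X : X \in semisimple_classes 3 F ->
    (Phi X == C) = (total_mup (cubic (class_coefs X)) == #|fixpts w0|).
  move=> /Phi_cubic ->; rewrite def_C; apply/eqP/eqP => [/setP/(_ w0)|->] //.
  by rewrite !inE eqxx => /eqP.
rewrite /unif_prob card_semisimple_classes natrX.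
have -> : [set X in semisimple_classes 3 F | Phi X == C] =
    [set X in semisimple_classes 3 F |
      total_mup (cubic (class_coefs X)) == #|fixpts w0|].
  by apply/setP => X; rewrite !inE; case: (boolP (X \in _)) => //= /Phi_C.
rewrite (card_classes_coefs (fun c => total_mup (cubic c) == #|fixpts w0|)).
rewrite -/(num_cubics F _) num_cubics_cellini natr_sum mulr_suml.
apply: eq_big => w; first by rewrite def_C inE.
by move=> _; rewrite ffunE.
Qed.
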